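(* Let $n\ge1$. Let $K(\bar x,\bar V;y,W)=\det(U)^{k/2}\exp F(\bar x,\bar V;y,W)$, $x,y\in\mathbb{C}^n$, $V,W\in\mathcal{D}_n$, be the reproducing kernel of the Siegel–Jacobi ball, with $U=(\mathbb{I}_n-W\bar V)^{-1}$ and $$2F(\bar x,\bar V;y,W)=2\langle x,Uy\rangle+\langle V\bar y,Uy\rangle+\langle x,UW\bar x\rangle .$$ Under the $FC$-change of coordinates $x=\eta-V\bar\eta$, $y=\xi-W\bar\xi$ ($\eta,\xi\in\mathbb{C}^n$), the kernel becomes $\mathcal{K}=K\circ FC$, where $$\mathcal{K}(\bar\eta,\bar V;\xi,W)=(\det U)^{k/2}\exp\mathcal{F},\qquad 2\mathcal{F}=\mathcal{F}_0+\Delta\mathcal{F},$$ $$\mathcal{F}_0=\bar\xi^t\xi+\bar\eta^t\eta-\bar\xi^tW\bar\xi-\eta^t\bar V\eta,$$ $$\Delta\mathcal{F}=(\bar\zeta^t-\zeta^t\bar V)U(\xi-W\bar\xi)+(\bar\eta^t-\eta^t\bar V)U(-\zeta+W\bar\zeta),\qquad \zeta=\eta-\xi .$$ In particular, for $\xi=\eta$, $V=W$ one has $\Delta\mathcal{F}=0$ and $$\mathcal{K}=\det(M)^{k/2}\exp(\mathcal{F}),\qquad M=(\mathbb{I}_n-W\bar W)^{-1},\qquad \mathcal{F}=\bar\eta^t\eta-\tfrac12\eta^t\bar W\eta-\tfrac12\bar\eta^tW\bar\eta,$$ and the scalar product $$(\phi,\psi)=\Lambda_n\int_{z\in\mathbb{C}^n,\,W\in\mathcal{D}_n}\bar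 f_\phi(z,W)f_\psi(z,W)\det(\mathbb{I}_n-W\bar W)^{k/2-n-2}e^{-F}\,dz\,dW$$ becomes $$(\phi,\psi)=\Lambda_n\int_{\eta\in\mathbb{C}^n,\ \mathbb{I}_n-W\bar W>0}\bar f_\phi(\eta,W)f_\psi(\eta,W)\,\rho_2\,d\eta\,dW,\qquad \rho_2=\det(\mathbb{I}_n-W\bar W)^{q}\exp(-\mathcal{F}),\quad q=\tfrac{k}{2}-n-1,$$ with the last $\mathcal{F}$. Moreover, with $F=F(z,\bar z,W,\bar W)$ the diagonal exponent (differentiated at fixed $z$) and the diagonal $\mathcal{F}$ (differentiated at fixed $\eta$), at corresponding points $z=\eta-W\bar\eta$, $$-\frac{\partial F}{\partial w_{ij}}=\frac{\partial\mathcal{F}}{\partial w_{ij}}=-\bar\eta_i\bar\eta_j+\tfrac12\bar\eta_i\bar\eta_j\delta_{ij},\qquad\text{or}\qquad \nabla F=-\nabla\mathcal{F}=\tfrac12\bar\eta\otimes\bar\eta .$$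
   Context: $A^t$ is the transpose, $\bar A$ the entrywise conjugate, $\mathbb{I}_n$ the identity; vectors are columns; $\langle x,y\rangle=\bar x^ty$ (antilinear in the first argument). Siegel ball: $\mathcal{D}_n=\{W\in M(n,\mathbb{C}):W=W^t,\ \mathbb{I}_n-W\bar W>0\}$; Siegel–Jacobi ball: $\mathbb{C}^n\times\mathcal{D}_n\ni(z,W)$. $k$ is the weight parameter. The $FC$ transform is $(\eta,W)\mapsto(z,W)$, $z=\eta-W\bar\eta$, with inverse $\eta=(\mathbb{I}_n-W\bar W)^{-1}(z+W\bar z)$. On the diagonal the exponent is $2F=2\bar z^tMz+z^t\bar WMz+\bar z^tMW\bar z$, $M=(\mathbb{I}_n-W\bar W)^{-1}$; this is the $F$ in the scalar product. $\Lambda_n$ is a fixed normalization constant, the same in both formulas for the scalar product. $dz=\prod_i d\Re z_i\,d\Im z_i$, $d\eta=\prod_i d\Re\eta_i\,d\Im\eta_i$, $dW=\prod_{i\le j}d\Re w_{ij}\,d\Im w_{ij}$. $f_\phi,f_\psi$ are holomorphic functions of $(z,W)$ in the Hilbert space with this scalar product, and $f(\eta,W)$ stands for $f(\eta-W\bar\eta,W)$. For symmetric $W$, $w_{ij}=w_{ji}$ is treated as one variable, i.e. $\frac{\partial w_{ij}}{\partial w_{pq}}=\delta_{ip}\delta_{jq}+\delta_{iq}\delta_{jp}-\delta_{ij}\delta_{pq}\delta_{ip}$; derivatives are holomorphic (Wirtinger) derivatives. $\nabla=(\nabla_{ij})$ with $\nabla_{ij}=\frac{1+\delta_{ij}}{2}\frac{\partial}{\partial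 w_{ij}}$ (no summation), and $(A\otimes B)_{ij}=a_ib_j$ for vectors. *)

(* Defs.v *)
From HB Require Import structures.
From mathcomp Require Export all_boot all_order all_algebra.
From mathcomp.real_closed Require Export complex.
From mathcomp Require Export all_classical all_reals all_analysis.

Set Implicit Arguments.
Unset Strict Implicit.
Unset Printing Implicit Defensive.

Import Order.TTheory GRing.Theory Num.Theory.
Import numFieldNormedType.Exports.

Local Open Scope classical_set_scope.
Local Open Scope ring_scope.
Local Open Scope complex_scope.

Section ComplexFunctions.
Variable R : realType.
Implicit Types (z : R[i]) (s : R).

Definition cexp z : R[i] :=
  (expR (complex.Re z))%:C * (cos (complex.Im z) +i* sin (complex.Im z)).

(* principal argument, in ]-pi, pi] for z != 0 *)
Definition carg z : R :=
  let a := acos (complex.Re z / complex.Re `|z|) in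
  if 0 <= complex.Im z then a else - a.

Definition clog z : R[i] := ln (complex.Re `|z|) +i* carg z.

(* principal power, meaningful for z != 0; on positive reals it is the usual
   real power *)
Definition cpow z s : R[i] := cexp (s%:C * clog z).

(* The branch of (\det A)^s given by exp (s tr Log A), with Log the principal
   matrix logarithm: the product of the principal powers of the eigenvalues,
   counted with multiplicity.  For V, W in the Siegel ball the eigenvalues of
   (1 - W \bar V)^-1 have positive real part, so that this is the branch which
   is holomorphic in (W, \bar V) and equal to 1 at V = W = 0.  The principal
   power of the determinant itself would be discontinuous for large n. *)
Definition det_pow n (A : 'M[R[i]]_n) s : R[i] :=
  \prod_(a <- sval (closed_field_poly_normal (char_poly A))) cpow a s.

End ComplexFunctions.

Section SiegelJacobi.
Variables (R : realType) (n : nat).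
Local Notation C := R[i].
Implicit Types (x y z eta xi : 'cV[C]_n) (V W : 'M[C]_n).

Definition cbar p q (A : 'M[C]_(p, q)) : 'M[C]_(p, q) := map_mx Num.conj A.

Definition dotp x y : C := ((cbar x)^T *m y) 0 0.

(* z < z' in R[i] entails that z' - z is real. *)
Definition posdef (A : 'M[C]_n) : Prop :=
  A^T = cbar A /\ (forall v : 'cV[C]_n, v != 0 -> 0 < dotp v (A *m v)).

Definition siegel_ball : set 'M[C]_n :=
  [set W | W = W^T /\ posdef (1%:M - W *m cbar W)].

Definition FC eta W : 'cV[C]_n := eta - W *m cbar eta.

Definition Umx V W : 'M[C]_n := invmx (1%:M - W *m cbar V).

Definition Mmx W : 'M[C]_n := invmx (1%:M - W *m cbar W).

(* The arguments (x, V; y, W) stand for (\bar x, \bar V; y, W). *)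
Definition Fexp x V y W : C :=
  (2 * dotp x (Umx V W *m y) + dotp (V *m cbar y) (Umx V W *m y)
   + dotp x (Umx V W *m W *m cbar x)) / 2.

Definition kernel (k : R) x V y W : C :=
  det_pow (Umx V W) (k / 2) * cexp (Fexp x V y W).

Definition calF0 eta V xi W : C :=
  ((cbar xi)^T *m xi + (cbar eta)^T *m eta
   - (cbar xi)^T *m W *m cbar xi - eta^T *m cbar V *m eta) 0 0.

Definition DeltaF eta V xi W : C :=
  let zeta := eta - xi in
  (((cbar zeta)^T - zeta^T *m cbar V) *m Umx V W *m (xi - W *m cbar xi)
   + ((cbar eta)^T - eta^T *m cbar V) *m Umx V W
       *m (- zeta + W *m cbar zeta)) 0 0.

Definition calF eta V xi W : C := (calF0 eta V xi W + DeltaF eta V xi W) / 2.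

Definition Fdiag z W : C :=
  ((2 *: ((cbar z)^T *m Mmx W *m z) + z^T *m cbar W *m Mmx W *m z
    + (cbar z)^T *m Mmx W *m W *m cbar z) 0 0) / 2.

Definition calFdiag eta W : C :=
  ((cbar eta)^T *m eta - 2^-1 *: (eta^T *m cbar W *m eta)
   - 2^-1 *: ((cbar eta)^T *m W *m cbar eta)) 0 0.

(* dW / dw_pq, where w_pq = w_qp is a single variable *)
Definition dsym (p q : 'I_n) : 'M[C]_n :=
  \matrix_(i, j) ((i == p)%:R * (j == q)%:R + (i == q)%:R * (j == p)%:R
                  - (i == j)%:R * (p == q)%:R * (i == p)%:R).

Definition rderivable (h : R -> C) : Prop :=
  derivable (fun t : R => complex.Re (h t)) 0 1 /\
  derivable (fun t : R => complex.Im (h t)) 0 1.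

Definition rderive (h : R -> C) : C :=
  derive1 (fun t : R => complex.Re (h t)) 0
  +i* derive1 (fun t : R => complex.Im (h t)) 0.

Definition along_re (G : 'M[C]_n -> C) W (p q : 'I_n) (t : R) : C :=
  G (W + (t +i* 0) *: dsym p q).
Definition along_im (G : 'M[C]_n -> C) W (p q : 'I_n) (t : R) : C :=
  G (W + (0 +i* t) *: dsym p q).

Definition wirtinger_derivable (G : 'M[C]_n -> C) W (p q : 'I_n) : Prop :=
  rderivable (along_re G W p q) /\ rderivable (along_im G W p q).

Definition wirtinger (G : 'M[C]_n -> C) W (p q : 'I_n) : C :=
  (rderive (along_re G W p q) - (0 +i* 1) * rderive (along_im G W p q)) / 2.

Definition nabla (G : 'M[C]_n -> C) W : 'M[C]_n :=
  \matrix_(i, j) ((1 + (i == j)%:R) / 2 * wirtinger G W i j).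

Definition outer (a b : 'cV[C]_n) : 'M[C]_n := \matrix_(i, j) (a i 0 * b j 0).

End SiegelJacobi.

Section LebesgueTuple.
Variable R : realType.
Local Notation T := (measurableTypeR R).

Definition cons_pair N (p : T * N.-tuple T) : N.+1.-tuple T :=
  [the N.+1.-tuple T of p.1 :: p.2].

Lemma measurable_cons_pair N : measurable_fun setT (@cons_pair N).
Proof. exact: measurable_cons. Qed.

Section step.
Variables (N : nat) (mu : {sigma_finite_measure set (N.-tuple T) -> \bar R}).

Let prod_mu := [the {measure set (T * N.-tuple T)%type -> \bar R} of
  ((@lebesgue_measure R) \x mu)%E].

Definition leb_step : set (N.+1.-tuple T) -> \bar R :=
  pushforward prod_mu (@cons_pair N).

Let leb_step0 : leb_step set0 = 0%E.
Proof. by rewrite /leb_step /pushforward preimage_set0 measure0. Qed.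

Let leb_step_ge0 A : (0 <= leb_step A)%E.
Proof. by rewrite /leb_step /pushforward; apply: (measure_ge0 prod_mu). Qed.

Let leb_step_additive : semi_sigma_additive leb_step.
Proof.
exact: (@measure_semi_sigma_additive _ _ _
  (measure_function_pushforward__canonical__measure_function_Measure
     prod_mu (@measurable_cons_pair N))).
Qed.

HB.instance Definition _ :=
  isMeasure.Build _ _ _ leb_step leb_step0 leb_step_ge0 leb_step_additive.

Lemma leb_step_sigma_finite : sigma_finite setT leb_step.
Proof.
have [F FT Foo] : sigma_finite setT prod_mu.
  have /sigma_finiteP[F [TF ndF Foo]] := sigma_finiteT (@lebesgue_measure R).
  have /sigma_finiteP[G [TG ndG Goo]] := sigma_finiteT mu.
  exists (fun i => F i `*` G i).
    rewrite -setXTT TF TG predeqE => -[x y]; split; last first.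
      by move=> [i _ [/= ? ?]]; split; exists i.
    move=> [/= [i _ Fix] [j _ Gjy]]; exists (maxn i j) => //; split.
      by move: x Fix; exact/subsetPset/ndF/leq_maxl.
    by move: y Gjy; exact/subsetPset/ndG/leq_maxr.
  move=> i; have [? ?] := Foo i; have [? ?] := Goo i.
  split; first exact: measurableX.
  by rewrite /= product_measure1E// lte_mul_pinfty// ge0_fin_numE.
pose g (t : N.+1.-tuple T) : T * N.-tuple T := (thead t, [tuple of behead t]).
have gK : g \o @cons_pair N = id.
  by apply/funext => -[x t]; rewrite /g /cons_pair /=; congr pair; apply/val_inj.
have mg : measurable_fun setT g.
  by apply/measurable_fun_pair; [exact: measurable_tnth|exact: measurable_behead].
exists (fun i => g @^-1` F i); first by rewrite -preimage_bigcup -FT preimage_setT.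
move=> i; have [mFi Fioo] := Foo i; split.
  by rewrite -[X in measurable X]setTI; exact: mg.
by rewrite /leb_step /pushforward -comp_preimage gK preimage_id.
Qed.

HB.instance Definition _ :=
  Measure_isSigmaFinite.Build _ _ _ leb_step leb_step_sigma_finite.

End step.

Fixpoint leb N : {sigma_finite_measure set (N.-tuple T) -> \bar R} :=
  if N is N'.+1 then leb_step (leb N') else dirac ([tuple] : 0.-tuple T).

End LebesgueTuple.

Section Integration.
Variables (R : realType) (n : nat).
Local Notation C := R[i].
Local Notation T := (measurableTypeR R).

Definition upper : finType := {p : 'I_n * 'I_n | (p.1 <= p.2)%N}.

Definition symmx (w : 'cV[C]_#|upper|) : 'M[C]_n :=
  \sum_(p : upper) w (enum_rank p) 0 *: dsym R (val p).1 (val p).2.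

(* the first half of the coordinates are the real parts *)
Definition cvec N (t : (N + N).-tuple T) : 'cV[C]_N :=
  \col_i ((tnth t (lshift N i) : R) +i* (tnth t (rshift N i) : R)).

Local Notation coords :=
  ((n + n).-tuple T * (#|upper| + #|upper|).-tuple T)%type.

Definition zof (p : coords) :
  'cV[C]_n := cvec p.1.
Definition Wof (p : coords) :
  'M[C]_n := symmx (cvec p.2).

(* dz dW, that is \prod_i dRe z_i dIm z_i \prod_(i <= j) dRe w_ij dIm w_ij *)
Definition volume :
  {measure set coords -> \bar R} :=
  [the {measure set coords -> \bar R} of
     (leb R (n + n) \x leb R (#|upper| + #|upper|))%E].

Definition ball_coords :
  set coords :=
  [set p | siegel_ball (Wof p)].

Definition integrand (g : 'cV[C]_n -> 'M[C]_n -> C)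
  (p : coords) : C :=
  g (zof p) (Wof p).

Definition SJ_integrable (g : 'cV[C]_n -> 'M[C]_n -> C) : Prop :=
  volume.-integrable ball_coords (fun p => (complex.Re (integrand g p))%:E) /\
  volume.-integrable ball_coords (fun p => (complex.Im (integrand g p))%:E).

Definition SJ_integral (g : 'cV[C]_n -> 'M[C]_n -> C) : C :=
  (\int[volume]_(p in ball_coords) complex.Re (integrand g p))
  +i* (\int[volume]_(p in ball_coords) complex.Im (integrand g p)).

Definition coordSpace : normedModType C := ('cV[C]_n * 'cV[C]_#|upper|)%type.

(* complex Frechet differentiability in the variables z_i, w_ij (i <= j) on
   C^n x D_n; the values of f elsewhere are irrelevant *)
Definition holomorphic (f : 'cV[C]_n -> 'M[C]_n -> C) : Prop :=
  forall p : coordSpace, siegel_ball (symmx p.2) ->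
    differentiable ((fun p => f p.1 (symmx p.2)) : coordSpace -> C^o) p.

Definition rho1 (k : R) (z : 'cV[C]_n) (W : 'M[C]_n) : C :=
  cpow (\det (1%:M - W *m cbar W)) (k / 2 - n%:R - 2) * cexp (- Fdiag z W).

Definition rho2 (k : R) (eta : 'cV[C]_n) (W : 'M[C]_n) : C :=
  cpow (\det (1%:M - W *m cbar W)) (k / 2 - n%:R - 1) * cexp (- calFdiag eta W).

Definition in_hilbert (k : R) (f : 'cV[C]_n -> 'M[C]_n -> C) : Prop :=
  holomorphic f /\
  SJ_integrable (fun z W => (f z W)^* * f z W * rho1 k z W).

End Integration.

(* Main.v *)
Require Import Defs.
From mathcomp Require Import measurable_realfun ring lra.

(** The algebraic identities reduce to the resolvent relation
(1 - W conj(V)) U = 1 and the symmetry of V and W.  They also give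
F(z, W) = 1/2 (z^* eta + z^t conj(eta)) with eta = FC^-1(z, W), whose increments
in W are exact pairings of eta(W'), eta(W) with W' - W; hence only the
continuity of eta in W is needed to differentiate F.

At fixed W the map eta |-> eta - W conj(eta) is real linear.  In the coordinates
(Re eta, Im eta) its matrix is positive definite (as a bilinear form), because
|W conj(eta)| < |eta| on the Siegel ball, and its determinant is
det(1 - W conj(W)).  For positive definite matrices the change of variables
follows by induction on the dimension from Tonelli's theorem: integrating out
the first coordinate replaces the matrix by its Schur complement. *)
Set Implicit Arguments.
Unset Strict Implicit.
Unset Printing Implicit Defensive.

Import Order.TTheory GRing.Theory Num.Theory.
Import numFieldNormedType.Exports.

Local Open Scope classical_set_scope.
Local Open Scope ring_scope.
Local Open Scope complex_scope.

(** * Matrix identities *)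

(** Conjugates are treated as independent variables: the identities live over an arbitrary
    commutative ring, with a' and [V] in the roles of conj(eta) and conj(V), so only the resolvent
    relation and symmetry can enter.

    On the diagonal, M is the inverse of a positive definite matrix, so its eigenvalues are positive
    and the eigenvalue-wise branch [det_pow] is the ordinary power of det M. Off the diagonal the
    eigenvalues are complex in general, and the branch stays as it is.

    Positive definiteness keeps the change of variables elementary: it passes to Schur complements,
    so no pivot vanishes, every scaling is orientation preserving, and no row exchange or absolute
    value appears. The resulting determinant turns the exponent k/2 - n - 2 into q.

    Two analytic gaps remain. Holomorphy refers to a normed space while integrals refer to a
    sigma-algebra on tuples; rational boxes connect the two. The Hilbert space only supplies
    integrability of |f|^2 rho_1; the mixed integrand is dominated by such terms, and its
    measurability is recovered from theirs. *)

Lemma addmxE (K : nmodType) p q (A B : 'M[K]_(p, q)) i j :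
  (A + B) i j = A i j + B i j.
Proof. by rewrite mxE. Qed.

Lemma oppmxE (K : zmodType) p q (A : 'M[K]_(p, q)) i j : (- A) i j = - A i j.
Proof. by rewrite mxE. Qed.

Lemma scalemxE (K : pzRingType) p q a (A : 'M[K]_(p, q)) i j :
  (a *: A) i j = a * A i j.
Proof. by rewrite mxE. Qed.

Lemma trmxB (K : zmodType) p q (A B : 'M[K]_(p, q)) : (A - B)^T = A^T - B^T.
Proof. by apply/matrixP => i j; rewrite !mxE. Qed.

Definition mxlinE := (addmxE, oppmxE, scalemxE).

(** In the application [V] is the conjugate of the original V. In terms of x and y, the Delta part
    is 2 x^T U y - (b'^T - b^T V) U y - x^T U (a - W a'), and the remaining part is b'^T y + x^T a.
    Inserting (1 - W V) U = 1 before y and U (1 - W V) = 1 after x^T, the leftover terms regroup as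
    (b^T - b'^T W) V U y = y^T V U y and x^T U W (a' - V a) = x^T U W x. *)
Lemma FC_identity (K : comNzRingType) n (a a' b b' : 'cV[K]_n)
    (V W U : 'M[K]_n) : V^T = V -> W^T = W ->
    (1%:M - W *m V) *m U = 1%:M -> U *m (1%:M - W *m V) = 1%:M ->
  let x := a' - V *m a in let y := b - W *m b' in
  x^T *m U *m y + x^T *m U *m y + y^T *m V *m U *m y + x^T *m U *m W *m x =
  b'^T *m b + a'^T *m a - b'^T *m W *m b' - a^T *m V *m a +
  (((a' - b')^T - (a - b)^T *m V) *m U *m y +
   (a'^T - a^T *m V) *m U *m (- (a - b) + W *m (a' - b'))).
Proof.
move=> VT WT US SU x y.
have xT : x^T = a'^T - a^T *m V by rewrite /x trmxB trmx_mul VT.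
have yT : y^T = b^T - b'^T *m W by rewrite /y trmxB trmx_mul WT.
have e1 : b'^T *m y = b'^T *m U *m y - b'^T *m W *m V *m U *m y.
  rewrite -mulmxBl; congr (_ *m y).
  by rewrite -[LHS]mulmx1 -US mulmxBl mul1mx mulmxBr !mulmxA.
have e2 : x^T *m a = x^T *m U *m a - x^T *m U *m W *m V *m a.
  rewrite -mulmxBl; congr (_ *m a).
  by rewrite -[LHS]mulmx1 -SU mulmxBr mulmx1 mulmxBr !mulmxA.
have e3 : b'^T *m b - b'^T *m W *m b' = b'^T *m y.
  by rewrite /y mulmxBr !mulmxA.
have e4 : a'^T *m a - a^T *m V *m a = x^T *m a.
  by rewrite xT mulmxBl.
rewrite -xT.
have -> : (a' - b')^T - (a - b)^T *m V = x^T - (b'^T - b^T *m V).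
  rewrite xT !trmxB mulmxBl; apply/matrixP => i j.
  by rewrite !mxlinE; ring.
have -> : - (a - b) + W *m (a' - b') = y - (a - W *m a').
  by rewrite /y mulmxBr; apply/matrixP => i j; rewrite !mxlinE; ring.
transitivity (b'^T *m y + x^T *m a +
   ((x^T - (b'^T - b^T *m V)) *m U *m y + x^T *m U *m (y - (a - W *m a')))).
  rewrite e1 e2 yT [in X in _ + X]/x.
  rewrite !(mulmxBl, mulmxBr, mulmxA); apply/matrixP => i j.
  by rewrite !mxlinE; ring.
by rewrite -e3 -e4; apply/matrixP => i j; rewrite !mxlinE; ring.
Qed.

Lemma FC_diag_identity (K : comNzRingType) n (a a' : 'cV[K]_n)
    (V W : 'M[K]_n) : V^T = V -> W^T = W ->
  let x := a' - V *m a in let y := a - W *m a' in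
  x^T *m a + y^T *m a' =
  a'^T *m a + a'^T *m a - a'^T *m W *m a' - a^T *m V *m a.
Proof.
move=> VT WT x y; rewrite /x /y !trmxB !trmx_mul VT WT !mulmxBl.
apply/matrixP => i j; rewrite !mxlinE.
have -> : (a^T *m a') i j = (a'^T *m a) i j.
  by rewrite !mxE; apply: eq_bigr => l _; rewrite !mxE !ord1 mulrC.
by ring.
Qed.

(** The vectors x and y have two presentations. Expanding x^T b and y^T b' with the first and x^T a
    and y^T a' with the second, the terms free of V and W cancel, since a scalar equals its
    transpose. The difference is exact, as in the resolvent identity: no second-order remainder is
    left. *)
Lemma FC_resolvent_identity (K : comNzRingType) n (a a' b b' : 'cV[K]_n)
    (V W V1 W1 : 'M[K]_n) : V^T = V -> W^T = W -> V1^T = V1 -> W1^T = W1 ->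
  let x := a' - V *m a in let y := a - W *m a' in
  b' - V1 *m b = x -> b - W1 *m b' = y ->
  x^T *m b + y^T *m b' - (x^T *m a + y^T *m a') =
  b^T *m (V1 - V) *m a + b'^T *m (W1 - W) *m a'.
Proof.
move=> VT WT V1T W1T x y xb yb.
have tr11 (u v : 'cV[K]_n) (A : 'M[K]_n) : A^T = A ->
    u^T *m A *m v = v^T *m A *m u.
  move=> AT; have -> : v^T *m A *m u = (u^T *m A *m v)^T.
    by rewrite !trmx_mul trmxK AT mulmxA.
  by apply/matrixP => i j; rewrite [RHS]mxE !ord1.
have tr1 (u v : 'cV[K]_n) : u^T *m v = v^T *m u.
  by have := tr11 u v 1%:M (trmx1 _ _); rewrite !mulmx1.
have -> : x^T *m b = a'^T *m b - a^T *m V *m b.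
  by rewrite /x trmxB trmx_mul VT mulmxBl.
have -> : y^T *m b' = a^T *m b' - a'^T *m W *m b'.
  by rewrite /y trmxB trmx_mul WT mulmxBl.
have -> : x^T *m a = b'^T *m a - b^T *m V1 *m a.
  by rewrite -xb trmxB trmx_mul V1T mulmxBl.
have -> : y^T *m a' = b^T *m a' - b'^T *m W1 *m a'.
  by rewrite -yb trmxB trmx_mul W1T mulmxBl.
rewrite (tr11 a b V VT) (tr11 a' b' W WT) (tr1 a' b) (tr1 a b').
rewrite !mulmxBr !mulmxBl; apply/matrixP => i j.
by rewrite !mxlinE; ring.
Qed.

Lemma half_double_sub (K : numFieldType) (a b c : K) :
  (a + a - b - c) / 2 = a - 2^-1 * c - 2^-1 * b.
Proof. by field. Qed.

(** * Conjugation, the Hermitian pairing and the contraction property of the Siegel ball *)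

Section Bar.
Variable R : realType.
Local Notation C := R[i].

Lemma conjE (x : C) : Num.conj x = x^*%C. Proof. by []. Qed.

Lemma cbarK p q (A : 'M[C]_(p, q)) : cbar (cbar A) = A.
Proof. by apply/matrixP => i j; rewrite !mxE conjCK. Qed.

Lemma cbarM p q r (A : 'M[C]_(p, q)) (B : 'M[C]_(q, r)) :
  cbar (A *m B) = cbar A *m cbar B.
Proof. exact: map_mxM. Qed.

Lemma cbarD p q (A B : 'M[C]_(p, q)) : cbar (A + B) = cbar A + cbar B.
Proof. exact: map_mxD. Qed.

Lemma cbarB p q (A B : 'M[C]_(p, q)) : cbar (A - B) = cbar A - cbar B.
Proof. exact: map_mxB. Qed.

Lemma cbarZ p q a (A : 'M[C]_(p, q)) : cbar (a *: A) = a^*%C *: cbar A.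
Proof. exact: map_mxZ. Qed.

Lemma cbarT p q (A : 'M[C]_(p, q)) : cbar A^T = (cbar A)^T.
Proof. by rewrite /cbar map_trmx. Qed.

Lemma cbar1 n : cbar 1%:M = 1%:M :> 'M[C]_n.
Proof. exact: map_mx1. Qed.

Lemma cbar_eq0 p q (A : 'M[C]_(p, q)) : (cbar A == 0) = (A == 0).
Proof. exact: map_mx_eq0. Qed.

Variable n : nat.
Implicit Types (x y z v : 'cV[C]_n) (A V W : 'M[C]_n).

Lemma dotpE x y : dotp x y = \sum_i (x i 0)^*%C * y i 0.
Proof. by rewrite /dotp mxE; apply: eq_bigr => i _; rewrite !mxE. Qed.

Lemma dotpC x y : dotp y x = (dotp x y)^*%C.
Proof.
rewrite !dotpE -conjE rmorph_sum /=; apply: eq_bigr => i _.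
by rewrite -!conjE rmorphM /= conjCK mulrC.
Qed.

Lemma dotp_cbar x y : dotp (cbar x) (cbar y) = dotp y x.
Proof.
by rewrite !dotpE; apply: eq_bigr => i _; rewrite !mxE -conjE conjCK mulrC.
Qed.

Lemma dotpDr x y z : dotp x (y + z) = dotp x y + dotp x z.
Proof. by rewrite /dotp mulmxDr mxE. Qed.
Lemma dotpBl x y z : dotp (x - y) z = dotp x z - dotp y z.
Proof. by rewrite /dotp cbarB trmxB mulmxBl !mxE. Qed.
Lemma dotpBr x y z : dotp x (y - z) = dotp x y - dotp x z.
Proof. by rewrite /dotp mulmxBr !mxE. Qed.
Lemma dotpZr a x y : dotp x (a *: y) = a * dotp x y.
Proof. by rewrite /dotp -scalemxAr mxE. Qed.
Lemma dotpZl a x y : dotp (a *: x) y = a^*%C * dotp x y.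
Proof. by rewrite /dotp cbarZ linearZ /= -scalemxAl mxE. Qed.

Lemma dotpMr x y A : dotp x (A *m y) = dotp ((cbar A)^T *m x) y.
Proof. by rewrite /dotp cbarM trmx_mul cbarT cbarK trmxK mulmxA. Qed.

Lemma dotp_ge0 x : 0 <= dotp x x.
Proof. by rewrite dotpE sumr_ge0// => i _; rewrite mulrC mulcJ_ge0. Qed.

Lemma dotp_gt0 x : x != 0 -> 0 < dotp x x.
Proof.
move=> x0; rewrite lt_def dotp_ge0 andbT; apply: contra x0; rewrite dotpE.
rewrite psumr_eq0 => [/allP h|i _]; last by rewrite mulrC mulcJ_ge0.
apply/eqP/colP => i; rewrite mxE; have := h i (mem_index_enum i).
by rewrite mulf_eq0 conjc_eq0 orbb => /eqP.
Qed.

Lemma siegel_sym W : siegel_ball W -> W^T = W.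
Proof. by case. Qed.

(** By symmetry of W, the pairing of v with W conj(W) v is |conj(W) v|^2, which conjugation turns
    into |W conj(v)|^2. *)
Lemma siegel_contract W v : siegel_ball W -> v != 0 ->
  dotp (W *m cbar v) (W *m cbar v) < dotp v v.
Proof.
move=> [Wsym [_ Wpos]] v0; have := Wpos v v0.
rewrite mulmxBl mul1mx dotpBr subr_gt0.
by rewrite -mulmxA (dotpMr v) -cbarT -Wsym -(dotp_cbar (cbar W *m v)) cbarM cbarK.
Qed.

Lemma siegel_le W v : siegel_ball W ->
  dotp (W *m cbar v) (W *m cbar v) <= dotp v v.
Proof.
move=> WD; have [->|v0] := eqVneq v 0; last exact/ltW/siegel_contract.
suff -> : cbar (0 : 'cV[C]_n) = 0 by rewrite mulmx0.
by apply/matrixP => i j; rewrite !mxE conjC0.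
Qed.

Lemma unitmx_ker A : (forall v, A *m v = 0 -> v = 0) -> A \in unitmx.
Proof.
move=> kerA; rewrite unitmxE unitfE -det_tr; apply/det0P => -[u u0 uA].
move/negP: u0; apply; rewrite -trmx_eq0; apply/eqP/kerA.
by apply: trmx_inj; rewrite trmx_mul trmxK uA trmx0.
Qed.

(** A kernel vector satisfies v = W conj(u) with u = V conj(v), whence |v| <= |u| < |v| if v is
    nonzero. The weak inequality is the one applied to u, which is not known to be nonzero at that
    point. *)
Lemma siegel_unit V W : siegel_ball V -> siegel_ball W ->
  1%:M - W *m cbar V \in unitmx.
Proof.
move=> VD WD; apply: unitmx_ker => v /eqP.
rewrite mulmxBl mul1mx subr_eq0 -mulmxA => /eqP vE.
apply/eqP/negPn/negP => v0.
set u := cbar (cbar V *m v); have uE : u = V *m cbar v.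
  by rewrite /u cbarM cbarK.
have := siegel_le u WD; rewrite /u cbarK -vE -/u uE => /le_lt_trans.
by move=> /(_ _ (siegel_contract VD v0)); rewrite ltxx.
Qed.

Lemma siegel_unit1 W : siegel_ball W -> 1%:M - W *m cbar W \in unitmx.
Proof. by move=> ?; exact: siegel_unit. Qed.

Lemma Fexp_FC eta xi V W : V^T = V -> W^T = W ->
  1%:M - W *m cbar V \in unitmx ->
  Fexp (FC eta V) V (FC xi W) W = calF eta V xi W.
Proof.
move=> VT WT US.
have VbT : (cbar V)^T = cbar V by rewrite -cbarT VT.
have := FC_identity eta (cbar eta) xi (cbar xi) VbT WT (mulmxV US) (mulVmx US).
rewrite /= -/(Umx V W); set U := Umx V W => E.
rewrite /Fexp /calF; congr (_ / _).
rewrite /calF0 /DeltaF /= -addmxE !cbarB -E.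
rewrite /dotp /FC -/U !(cbarM, cbarB, cbarK) trmx_mul VbT !mulmxA !addmxE.
by rewrite mulr_natl mulr2n.
Qed.

Lemma Fexp_diag z W : W^T = W -> Fexp z W z W = Fdiag z W.
Proof.
move=> WT; rewrite /Fexp /Fdiag /dotp -/(Mmx W); congr (_ / _).
have WbT : (cbar W)^T = cbar W by rewrite -cbarT WT.
by rewrite cbarM cbarK trmx_mul WbT !mulmxA !mxlinE.
Qed.

Lemma DeltaF_diag eta W : DeltaF eta W eta W = 0.
Proof.
rewrite /DeltaF /= subrr.
have -> : cbar (0 : 'cV[C]_n) = 0.
  by apply/matrixP => i j; rewrite !mxE conjC0.
by rewrite trmx0 !mul0mx subr0 !mul0mx mulmx0 oppr0 addr0 mulmx0 addr0 mxE.
Qed.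

Lemma calF_diag eta W : calF eta W eta W = calFdiag eta W.
Proof.
rewrite /calF DeltaF_diag addr0 /calF0 /calFdiag !mxlinE.
exact: half_double_sub.
Qed.

Lemma Fdiag_FC eta W : W^T = W -> 1%:M - W *m cbar W \in unitmx ->
  Fdiag (FC eta W) W = calFdiag eta W.
Proof. by move=> WT WU; rewrite -Fexp_diag// Fexp_FC// calF_diag. Qed.

End Bar.

(** * Powers of determinants *)

Section Power.
Variable R : realType.
Local Notation C := R[i].

Lemma cexp_real (r : R) : cexp r%:C = (expR r)%:C.
Proof. by rewrite /cexp /= cos0 sin0 complexr0 mulr1. Qed.

Lemma gt0_real (a : C) : 0 < a -> exists2 r : R, 0 < r & a = r%:C.
Proof.
case: a => r s; rewrite ltcE /= => /andP[/eqP -> r0].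
by exists r.
Qed.

Lemma cpow_real (r s : R) : 0 < r -> cpow r%:C s = (expR (s * ln r))%:C.
Proof.
move=> r0; rewrite -cexp_real /cpow /clog /carg /= lexx.
rewrite expr0n addr0 sqrtr_sqr gtr0_norm// divff ?gt_eqF// acos1.
by rewrite complexr0 -rmorphM.
Qed.

(** Principal powers are multiplicative here because all arguments are 0; for general complex
    factors the logarithms may differ by a multiple of 2 pi i. *)
Lemma cpow_prod (s : seq C) (t : R) : (forall a, a \in s -> 0 < a) ->
  0 < \prod_(a <- s) a /\ \prod_(a <- s) cpow a t = cpow (\prod_(a <- s) a) t.
Proof.
elim: s => [|a s IH] s0.
  by rewrite !big_nil ltr01 (cpow_real _ ltr01) ln1 mulr0 expR0.
have [|p0 pE] := IH; first by move=> b bs; apply: s0; rewrite inE bs orbT.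
have a0 : 0 < a by apply: s0; rewrite mem_head.
rewrite !big_cons pE mulr_gt0//; split=> //.
have [r r0 ->] := gt0_real a0; have [q q0 ->] := gt0_real p0.
rewrite -(rmorphM (real_complex R)) !cpow_real ?mulr_gt0// -rmorphM /=.
by rewrite -expRD lnM ?posrE// mulrDr.
Qed.

Lemma cpowM_self (d s : R) : 0 < d -> cpow d%:C s * d%:C = cpow d%:C (s + 1).
Proof.
by move=> d0; rewrite !cpow_real// -rmorphM /= mulrDl mul1r expRD lnK.
Qed.

Variable n : nat.
Implicit Types (A W : 'M[C]_n).

(** Eigenvectors are rows: v A^-1 = a v gives v = a v A. Multiplying by the conjugate transpose x of
    v yields |x|^2 = a <x, A x>, with both pairings positive. *)
Lemma posdef_invmx_eig A (a : C) : posdef A -> A \in unitmx ->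
  eigenvalue (invmx A) a -> 0 < a.
Proof.
move=> [_ Apos] uA /eigenvalueP[v vE v0].
have vE' : v = a *: (v *m A).
  by rewrite scalemxAl -vE -mulmxA mulVmx// mulmx1.
set x := (cbar v)^T; have x0 : x != 0 by rewrite trmx_eq0 cbar_eq0.
have xE : (cbar x)^T = v by rewrite /x -cbarT trmxK cbarK.
have := dotp_gt0 x0; rewrite /dotp xE {1}vE' -scalemxAl -mulmxA mxE.
have := Apos x x0; rewrite /dotp xE => h.
by rewrite pmulr_lgt0.
Qed.

(** The product in [det_pow] runs over the roots of the characteristic polynomial. Its constant
    coefficient, (-1)^n det A on one side and the product of the -a on the other, identifies the
    product of the roots with det A. *)
Lemma det_pow_pos A s : (forall a, eigenvalue A a -> 0 < a) ->
  0 < \det A /\ det_pow A s = cpow (\det A) s.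
Proof.
move=> Apos; rewrite /det_pow.
case: closed_field_poly_normal => /= r; rewrite (monicP (char_poly_monic A)).
rewrite scale1r => rE.
have rpos a : a \in r -> 0 < a.
  by move=> ar; apply: Apos; rewrite eigenvalue_root_char rE root_prod_XsubC.
have sr : size r = n.
  have := size_char_poly A; rewrite rE size_prod_XsubC => -[].
  by [].
suff -> : \det A = \prod_(a <- r) a by exact: cpow_prod.
have := char_poly_det A; rewrite rE -horner_coef0 horner_prod.
under eq_bigr do rewrite hornerXsubC sub0r.
rewrite (eq_bigr (fun a => -1 * a)); last by move=> a _; rewrite mulN1r.
rewrite big_split /= big_const_seq count_predT sr iter_mulr_1.
by move/(mulfI _) => ->//; rewrite signr_eq0.
Qed.

Lemma siegel_det_gt0 W : siegel_ball W -> 0 < \det (Mmx W).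
Proof.
move=> WD; have [|//] := @det_pow_pos (Mmx W) 0 => a.
by apply: posdef_invmx_eig; [case: WD | exact: siegel_unit1].
Qed.

Lemma det_pow_Mmx W s : siegel_ball W ->
  det_pow (Mmx W) s = cpow (\det (Mmx W)) s.
Proof.
move=> WD; have [|//] := @det_pow_pos (Mmx W) s => a.
by apply: posdef_invmx_eig; [case: WD | exact: siegel_unit1].
Qed.

Lemma siegel_det_inv_gt0 W : siegel_ball W ->
  0 < \det (1%:M - W *m cbar W).
Proof.
by move=> WD; rewrite -invr_gt0 -det_inv; exact: siegel_det_gt0.
Qed.

End Power.

(** * Linear change of variables for iterated Lebesgue measure *)

Section PositiveMatrix.
Variable R : realFieldType.

Definition pos_form N (A : 'M[R]_N) : Prop :=
  forall v : 'I_N -> R, (exists i, v i != 0) ->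
    0 < \sum_i \sum_j v i * A i j * v j.

Definition schur N (A : 'M[R]_(1 + N)) : 'M[R]_N :=
  drsubmx A - (A ord0 ord0)^-1 *: (dlsubmx A *m ursubmx A).

Lemma schurE N (A : 'M[R]_(1 + N)) i j :
  schur A i j = A (lift ord0 i) (lift ord0 j)
    - (A ord0 ord0)^-1 * (A (lift ord0 i) ord0 * A ord0 (lift ord0 j)).
Proof. by rewrite /schur !mxE big_ord1 !mxE !lshift0 !rshift1. Qed.

Lemma pos_form00 N (A : 'M[R]_(1 + N)) : pos_form A -> 0 < A ord0 ord0.
Proof.
move=> /(_ (fun i => (i == ord0)%:R)); rewrite (bigD1 ord0)//= (bigD1 ord0)//=.
rewrite !big1 ?mul1r ?mulr1 ?addr0; last first.
- by move=> j /negPf ->; rewrite mulr0.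
- by move=> i /negPf ->; rewrite big1// => j _; rewrite mul0r mul0r.
by apply; exists ord0; rewrite eqxx oner_eq0.
Qed.

(** Block LU factorisation with the top left entry as pivot. *)
Lemma det_schur N (A : 'M[R]_(1 + N)) : A ord0 ord0 != 0 ->
  \det A = A ord0 ord0 * \det (schur A).
Proof.
move=> a0.
have {1}-> : A = block_mx 1%:M 0 ((A ord0 ord0)^-1 *: dlsubmx A) 1%:M *m
  block_mx (ulsubmx A) (ursubmx A) 0 (schur A).
  have ulE : ulsubmx A = (A ord0 ord0)%:M.
    by apply/matrixP => i j; rewrite !ord1 !mxE !lshift0 eqxx.
  rewrite mulmx_block !mul1mx !mul0mx !addr0.
  rewrite ulE mul_mx_scalar scalerA divff// scale1r -scalemxAl subrKC.
  by rewrite -ulE submxK.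
rewrite det_mulmx det_lblock det_ublock !det1 !mul1r det_mx11.
by rewrite !mxE !lshift0.
Qed.

(** The vector v is extended by the first coordinate -r/a, chosen so that the first component of A w
    vanishes. The remaining components of A w are then those of the Schur complement applied to v,
    so both quadratic forms take the same value. *)
Lemma pos_form_schur N (A : 'M[R]_(1 + N)) : pos_form A -> pos_form (schur A).
Proof.
move=> Apos v [k vk]; have a0 := pos_form00 Apos; set a := A ord0 ord0 in a0.
pose r := \sum_j A ord0 (lift ord0 j) * v j.
pose w (i : 'I_(1 + N)) := oapp v (- r / a) (unlift ord0 i).
have w0 : w ord0 = - r / a by rewrite /w unlift_none.
have wS i : w (lift ord0 i) = v i by rewrite /w liftK.
have /Apos : exists i, w i != 0 by exists (lift ord0 k); rewrite wS.
rewrite !big_ord_recl/= w0.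
have -> : - r / a * A ord0 ord0 * (- r / a) +
    \sum_(j < N) - r / a * A ord0 (lift ord0 j) * w (lift ord0 j) = 0.
  under eq_bigr do rewrite wS -mulrA.
  by rewrite -mulr_sumr -/r -/a; field; rewrite gt_eqF.
rewrite add0r; congr (_ < _); apply: eq_bigr => i _.
rewrite big_ord_recl w0 wS.
transitivity (\sum_(j < N) (v i * A (lift ord0 i) (lift ord0 j) * v j -
  v i * A (lift ord0 i) ord0 / a * (A ord0 (lift ord0 j) * v j))).
  rewrite sumrB -mulr_sumr -/r addrC; congr (_ + _); last first.
    by rewrite -/(\sum_j _); field; rewrite gt_eqF.
  by apply: eq_bigr => j _; rewrite wS.
by apply: eq_bigr => j _; rewrite schurE -/a; ring.
Qed.

Lemma pos_form_det N (A : 'M[R]_N) : pos_form A -> 0 < \det A.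
Proof.
elim: N A => [|N IH] A Apos; first by rewrite det_mx00 ltr01.
have a0 := pos_form00 (Apos : @pos_form (1 + N) A).
by rewrite (@det_schur N A) ?gt_eqF// mulr_gt0// IH//; exact: pos_form_schur.
Qed.

End PositiveMatrix.

Section ChangeOfVariables.
Variable R : realType.
Local Notation T := (measurableTypeR R).
Local Open Scope ereal_scope.

(** The image of Lebesgue measure under x |-> a x + b, multiplied by a, gives half-open intervals
    their length, so it is Lebesgue measure by uniqueness. *)
Lemma integral_affine (a b : R) (f : T -> \bar R) : (0 < a)%R ->
  measurable_fun setT f -> (forall x, 0 <= f x) ->
  \int[@lebesgue_measure R]_x f (a * x + b)%R =
  (a^-1)%:E * \int[@lebesgue_measure R]_x f x.
Proof.
move=> a0 mf f0; pose phi (x : T) : T := (a * x + b)%R.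
have mphi : measurable_fun setT phi.
  by apply: measurable_funD => //; exact: measurable_funM.
pose mu : {measure set T -> \bar R} :=
  measure_function_pushforward__canonical__measure_function_Measure
    (@lebesgue_measure R) mphi.
pose nu : {measure set T -> \bar R} := mscale (NngNum (ltW a0)) mu.
have nuE A : measurable A -> lebesgue_measure A = nu A.
  apply: lebesgue_measure_unique => X [[l r] _ <-] /=.
  rewrite /nu /mscale /mu /= /pushforward.
  have -> : phi @^-1` `]l, r] = [set` `]((l - b) / a)%R, ((r - b) / a)%R]].
    apply/seteqP; split => x /=; rewrite !in_itv/= /phi.
      by rewrite ltr_pdivrMr// ler_pdivlMr// ltrBlDr lerBrDr mulrC.
    by rewrite ltr_pdivrMr// ler_pdivlMr// ltrBlDr lerBrDr mulrC.
  rewrite !lebesgue_measure_itv/= !lte_fin.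
  rewrite ltr_pM2r ?invr_gt0// ltrD2r; case: ifPn => _; last by rewrite mule0.
  rewrite -!EFinB -EFinM; congr (_%:E); field; by rewrite gt_eqF.
rewrite (@eq_measure_integral _ _ _ setT nu (@lebesgue_measure R) f); last first.
  by move=> A mA _; exact: nuE.
rewrite (@ge0_integral_mscale _ _ _ mu setT measurableT (NngNum (ltW a0)) f)//.
rewrite muleA -EFinM/= mulVf ?gt_eqF// mul1e.
by rewrite (ge0_integral_pushforward mphi).
Qed.

Lemma integral_lebS N (f : N.+1.-tuple T -> \bar R) :
  measurable_fun setT f -> (forall x, 0 <= f x) ->
  \int[leb R N.+1]_t f t =
  \int[@lebesgue_measure R]_x \int[leb R N]_t f (cons_pair (x, t)).
Proof.
move=> mf f0.
rewrite -(fubini_tonelli1 (fun p => f (cons_pair p)))//; last first.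
  by apply: measurableT_comp => //; exact: measurable_cons_pair.
rewrite -[LHS]/(\int[pushforward ((@lebesgue_measure R) \x leb R N)
  (@cons_pair R N)]_t f t).
by rewrite ge0_integral_pushforward//; exact: measurable_cons_pair.
Qed.

(** The translation is there for the induction: once the first coordinate is eliminated, the
    remaining ones are shifted by an amount depending on it. *)
Definition aff N (A : 'M[R]_N) (b : 'cV[R]_N) (t : N.-tuple T) : N.-tuple T :=
  [tuple (\sum_j A i j * tnth t j + b i ord0)%R | i < N].

Lemma measurable_tuple d (S : measurableType d) N (h : 'I_N -> S -> T) :
  (forall i, measurable_fun setT (h i)) ->
  measurable_fun setT (fun x => [tuple h i x | i < N]).
Proof.
move=> mh; apply/measurable_fun_tnthP => i.
by rewrite (_ : _ \o _ = h i)//; apply/funext => x /=; rewrite tnth_mktuple.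
Qed.

Lemma measurable_aff N A b : measurable_fun setT (@aff N A b).
Proof.
apply: measurable_tuple => i; apply: measurable_funD => //.
apply: measurable_sum => j; apply: measurable_funM => //.
exact: measurable_tnth.
Qed.

Lemma integral_aff N (A : 'M[R]_N) b (f : N.-tuple T -> \bar R) :
  pos_form A -> measurable_fun setT f -> (forall x, 0 <= f x) ->
  \int[leb R N]_t f (aff A b t) = ((\det A)^-1)%:E * \int[leb R N]_t f t.
Proof.
elim: N A b f => [|N IH] A b f Apos mf f0.
  rewrite det_mx00 invr1 mul1e; apply: eq_integral => t _.
  by rewrite (tuple0 t) (tuple0 (aff _ _ _)).
have a0 := pos_form00 (Apos : @pos_form _ (1 + N) A).
set a := A _ _ in a0.
have Spos := pos_form_schur (Apos : @pos_form _ (1 + N) A).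
set S := schur _ in Spos.
(* Here u is the new first coordinate, a x + r(t) + b_0, where r(t) is the rest of row 0 applied to
   t. Substituting x = (u - b_0 - r(t)) / a into row i leaves the Schur complement applied to t,
   plus this shift. *)
pose c (u : R) : 'cV[R]_N := \col_i (b (lift ord0 i) ord0 +
   (u - b ord0 ord0) / a * A (lift ord0 i) ord0)%R.
pose G (p : T * N.-tuple T) : \bar R := f (cons_pair (p.1, aff S (c p.1) p.2)).
have mG : measurable_fun setT G.
  apply: measurableT_comp => //; apply: measurableT_comp.
    exact: measurable_cons_pair.
  apply/measurable_fun_pair => //=; apply: measurable_tuple => i.
  apply: measurable_funD.
    apply: measurable_sum => j; apply: measurable_funM => //.
    exact: (measurableT_comp (measurable_tnth j) measurable_snd).
  under eq_fun do rewrite /c mxE.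
  apply: measurable_funD => //; apply: measurable_funM => //.
  by apply: measurable_funM => //; exact: measurable_funB.
have G0 p : 0 <= G p by exact: f0.
have mG1 t : measurable_fun setT (fun x : T => G (x, t)).
  exact: (measurableT_comp mG (measurable_pair2 t)).
have affE x t : f (aff A b (cons_pair (x, t))) =
    G ((a * x + (\sum_j A ord0 (lift ord0 j) * tnth t j + b ord0 ord0))%R, t).
  congr (f _); apply: eq_from_tnth => i.
  rewrite tnth_mktuple big_ord_recl.
  have tE j : tnth (cons_pair (x, t)) (lift ord0 j) = tnth t j.
    by rewrite tnthS.
  have t0 : tnth (cons_pair (x, t)) ord0 = x by [].
  under eq_bigr do rewrite tE; rewrite t0.
  case: (unliftP ord0 i) => [j|] -> ; last by rewrite /= -addrA.
  rewrite [RHS]tnthS tnth_mktuple mxE /=.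
  under [in RHS]eq_bigr do rewrite schurE -/a mulrBl -!mulrA.
  rewrite sumrB -!mulr_sumr; field; by rewrite gt_eqF.
have maff : measurable_fun setT (fun t => f (aff A b t)).
  by apply: measurableT_comp => //; exact: measurable_aff.
rewrite integral_lebS//.
have mfc : measurable_fun setT (fun p : T * N.-tuple T => f (cons_pair p)).
  by apply: measurableT_comp => //; exact: measurable_cons_pair.
have mfc1 x : measurable_fun setT (fun t : N.-tuple T => f (cons_pair (x, t))).
  exact: (measurableT_comp mfc (measurable_pair1 x)).
(* The integral in x is moved inside: at fixed t the first row is an affine map of x with slope
   a. *)
rewrite (fubini_tonelli (fun p => f (aff A b (cons_pair p))))//; last first.
  by apply: (measurableT_comp maff); exact: measurable_cons_pair.
under eq_integral => t _.
  under eq_integral do rewrite affE.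
  rewrite (integral_affine _ a0 (mG1 t) (fun x => G0 (x, t))).
  over.
rewrite ge0_integralZl//; last 3 first.
- exact: (measurable_fun_fubini_tonelli_G G).
- by move=> t _; apply: integral_ge0.
- by rewrite lee_fin invr_ge0 ltW.
(* The order is exchanged back, so that the induction hypothesis applies in t at each fixed value of
   the new first coordinate. *)
rewrite -(fubini_tonelli G)//.
under eq_integral => x _.
  rewrite (IH S (c x) _ Spos (mfc1 x) (fun t => f0 _)).
  over.
have S0 := pos_form_det Spos.
rewrite ge0_integralZl//; last 3 first.
- exact: (measurable_fun_fubini_tonelli_F (fun p => f (cons_pair p))).
- by move=> t _; apply: integral_ge0.
- by rewrite lee_fin invr_ge0 ltW.
rewrite muleA -EFinM -invfM integral_lebS//; congr ((_^-1)%:E * _).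
by rewrite (@det_schur _ N A) ?gt_eqF.
Qed.

End ChangeOfVariables.

(** * The real matrix of the FC transform *)

(** With e a square root of -1, [J] sends (x, y) to (x + e y, x - e y), that is, real and imaginary
    parts to (z, conj(z)). It conjugates the given matrix to [D], the map (z, z') |-> (z - W z', z'
    - W' z), whose determinant follows from a block triangular factorisation. [J] is invertible
    because [J *m J'] is twice the identity. *)
Lemma det_antilinear (K : numFieldType) n (e : K) (P Q : 'M[K]_n) :
  e * e = -1 ->
  \det (block_mx (1%:M - P) (- Q) (- Q) (1%:M + P)) =
  \det (1%:M - (P + e *: Q) *m (P - e *: Q)).
Proof.
move=> ee; set B := block_mx _ _ _ _.
pose J : 'M[K]_(n + n) := block_mx 1%:M e%:M 1%:M (- e)%:M.
pose J' : 'M[K]_(n + n) := block_mx 1%:M 1%:M (- e)%:M e%:M.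
set W := P + _; set W' := P - _.
pose D : 'M[K]_(n + n) := block_mx 1%:M (- W) (- W') 1%:M.
have JJ' : J *m J' = 2%:M.
  rewrite mulmx_block !mul1mx -!scalar_mxM !mulrN !mulNr opprK ee opprK.
  have -> : (-1)%:M = - 1%:M :> 'M[K]_n.
    by apply/matrixP => i j; rewrite !mxE mulNrn.
  have -> : 1%:M + 1%:M = 2%:M :> 'M[K]_n.
    by apply/matrixP => i j; rewrite !mxE -mulrnDl.
  by rewrite subrr -scalar_mx_block.
have JB : J *m B = D *m J.
  rewrite !mulmx_block !mul1mx !mulmx1 !(mul_scalar_mx, mul_mx_scalar).
  have eeQ : e *: (e *: Q) = - Q by rewrite scalerA ee scaleN1r.
  have scN : (- e)%:M = - (e *: 1%:M) :> 'M[K]_n.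
    by rewrite scalemx1; apply/matrixP => i j; rewrite !mxE mulNrn.
  rewrite scN -(scalemx1 _ e) /W /W' !scaleNr !scalerN !scalerDr !scalerN eeQ.
  by congr block_mx; apply/matrixP => i j; rewrite !mxlinE; ring.
have detJ : \det J != 0.
  have : \det (J *m J') != 0.
    by rewrite JJ' det_scalar expf_neq0// pnatr_eq0.
  by rewrite det_mulmx mulf_eq0 negb_or => /andP[].
apply: (mulfI detJ); rewrite -det_mulmx JB det_mulmx mulrC; congr (_ * _).
have -> : D = block_mx 1%:M (- W) 0 1%:M *m block_mx (1%:M - W *m W') 0 (- W') 1%:M.
  by rewrite mulmx_block !mul1mx !mul0mx !mulmx1 mulNmx mulmxN opprK subrK !add0r.
by rewrite det_mulmx det_ublock det_lblock !det1 !mul1r mulr1.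
Qed.

Section RealMatrix.
Variable R : realType.
Local Notation C := R[i].
Variable n : nat.
Implicit Types W : 'M[C]_n.

Definition Re_mx W : 'M[R]_n := \matrix_(i, j) complex.Re (W i j).
Definition Im_mx W : 'M[R]_n := \matrix_(i, j) complex.Im (W i j).

Definition FCmx W : 'M[R]_(n + n) :=
  block_mx (1%:M - Re_mx W) (- Im_mx W) (- Im_mx W) (1%:M + Re_mx W).

Definition cpair (v : 'I_(n + n) -> R) : 'cV[C]_n :=
  \col_i (v (lshift n i) +i* v (rshift n i)).

Lemma Re_sum I (r : seq I) (F : I -> C) :
  complex.Re (\sum_(i <- r) F i) = \sum_(i <- r) complex.Re (F i).
Proof. by elim/big_ind2: _ => // _ a _ b <- <-; case: a; case: b. Qed.

Lemma Im_sum I (r : seq I) (F : I -> C) :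
  complex.Im (\sum_(i <- r) F i) = \sum_(i <- r) complex.Im (F i).
Proof. by elim/big_ind2: _ => // _ a _ b <- <-; case: a; case: b. Qed.

Lemma FCmx_cpair W v : cpair (fun i => \sum_j FCmx W i j * v j) = FC (cpair v) W.
Proof.
apply/matrixP => i j; rewrite ord1 {j}.
have sum1 (u : 'I_n -> R) : u i = \sum_j (i == j)%:R * u j.
  rewrite (bigD1 i)//= eqxx mul1r big1 ?addr0// => j /negPf.
  by rewrite eq_sym => ->; rewrite mul0r.
rewrite /FC !mxE; apply/eqP; rewrite eq_complex /=; apply/andP; split; apply/eqP.
- rewrite big_split_ord /= raddfB /= Re_sum {1}(sum1 (fun i => v (lshift n i))).
  rewrite -sumrB -big_split; apply: eq_bigr => j _.
  rewrite /FCmx block_mxEul block_mxEur !mxE.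
  by case: (W i j) => a b /=; ring.
- rewrite big_split_ord /= raddfB /= Im_sum {1}(sum1 (fun i => v (rshift n i))).
  rewrite -sumrB -big_split; apply: eq_bigr => j _.
  rewrite /FCmx block_mxEdl block_mxEdr !mxE.
  by case: (W i j) => a b /=; ring.
Qed.

(** From |eta - u|^2 >= 0 one gets 2 Re<eta, u> <= |eta|^2 + |u|^2 < 2 |eta|^2. *)
Lemma dotp_FC_gt0 W (eta : 'cV[C]_n) : siegel_ball W -> eta != 0 ->
  0 < complex.Re (dotp eta (FC eta W)).
Proof.
move=> WD eta0; set u := W *m cbar eta.
have := siegel_contract WD eta0; rewrite -/u ltcE => /andP[_ lt_u].
have := dotp_ge0 (eta - u); rewrite lecE => /andP[_].
rewrite /FC -/u !dotpBl !dotpBr (dotpC eta u).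
move: lt_u; case: (dotp eta eta) => a a'; case: (dotp u u) => b b'.
case: (dotp eta u) => c c' /=; lra.
Qed.

(** The quadratic form of [FCmx W] at (Re eta, Im eta) is the real part of <eta, FC eta W>. *)
Lemma FCmx_pos W : siegel_ball W -> pos_form (FCmx W).
Proof.
move=> WD v [k vk]; have vE := FCmx_cpair W v.
have eta0 : cpair v != 0.
  apply: contra_neq vk => /colP c0; rewrite -(splitK k) /unsplit.
  by case: (fintype.split k) => i; have := c0 i; rewrite !mxE => -[].
have := dotp_FC_gt0 WD eta0; rewrite -vE dotpE Re_sum => h.
have -> // : \sum_i \sum_j v i * FCmx W i j * v j = \sum_i
  complex.Re ((cpair v i 0)^*%C * cpair (fun i => \sum_j FCmx W i j * v j) i 0).
under eq_bigr do under eq_bigr do rewrite -mulrA.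
under eq_bigr do rewrite -mulr_sumr.
rewrite big_split_ord /= -big_split; apply: eq_bigr => i _.
by rewrite !mxE /= mulNr opprK.
Qed.

Lemma det_FCmx W : (\det (FCmx W))%:C = \det (1%:M - W *m cbar W).
Proof.
pose P := map_mx (real_complex R) (Re_mx W).
pose Q := map_mx (real_complex R) (Im_mx W).
have WE : W = P + 'i%C *: Q.
  by apply/matrixP => i j; rewrite !mxE; case: (W i j) => a b; simpc.
have WbE : cbar W = P - 'i%C *: Q.
  have cr (A : 'M[R]_n) :
      cbar (map_mx (real_complex R) A) = map_mx (real_complex R) A.
    by apply/matrixP => i j; rewrite !mxE conjE conjc_real.
  have ci : ('i%C : C)^*%C = - 'i%C by simpc.
  by rewrite WE cbarD cbarZ !cr ci scaleNr.
rewrite -[LHS](det_map_mx (real_complex R)) /FCmx map_block_mx.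
rewrite !(map_mxD, map_mxN, map_mx1) -/P -/Q (@det_antilinear _ _ 'i%C).
  by rewrite -WE -WbE.
by rewrite -expr2 sqr_i.
Qed.

End RealMatrix.

(** * Measurability of open sets *)

Section OpenMeasurable.
Variable R : realType.

(** The set is the union of the countably many rational boxes that it contains. Openness is
    expressed through the coordinates [h], so that [S] carries only its sigma-algebra. *)
Lemma box_open_measurable d (S : measurableType d) (J : finType)
    (h : J -> S -> R) (A : set S) :
  (forall i, measurable_fun setT (h i)) ->
  (forall p, A p -> exists2 e, 0 < e &
     forall q, (forall i, `|h i q - h i p| < e) -> A q) ->
  measurable A.
Proof.
move=> mh Aopen.
pose B (x : {ffun J -> rat} * nat) : set S :=
  [set q | forall i, `|h i q - ratr (x.1 i)| < x.2.+1%:R^-1].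
have mB x : measurable (B x).
  have -> : B x = \bigcap_(i in [set: J]) h i @^-1`
      [set` `](ratr (x.1 i) - x.2.+1%:R^-1), (ratr (x.1 i) + x.2.+1%:R^-1)[].
    apply/seteqP; split => q /= hq i; first move=> _; rewrite /= ?in_itv/=.
      by have := hq i; rewrite ltr_distl.
    by have := hq i I; rewrite /= in_itv/= ltr_distl.
  apply: fin_bigcap_measurable => // i _; rewrite -[X in measurable X]setTI.
  by apply: mh => //; exact: measurable_itv.
have -> : A = \bigcup_x (if `[< B x `<=` A >] then B x else set0).
  apply/seteqP; split => [p Ap|p [x _]]; last by case: asboolP => // BA /BA.
  have [e e0 eA] := Aopen p Ap.
  (* The rational centre and the points of the box are each within 1/(k+1) < e/2, so the box stays
     within e of p. *)
  have e20 : 0 < e / 2 by rewrite divr_gt0.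
  have [k _ /(_ k (leqnn k)) ke] := near_infty_natSinv_lt (PosNum e20).
  have /choice[c hc] i : exists r : rat, `|h i p - ratr r| < k.+1%:R^-1.
    have [|r] := @rat_in_itvoo R (h i p - k.+1%:R^-1) (h i p + k.+1%:R^-1).
      by rewrite ltrD2l gtrN// invr_gt0 ltr0n.
    by rewrite in_itv/= -ltr_distl distrC; exists r.
  exists ([ffun i => c i], k) => //; case: asboolP => [_ i|].
    by rewrite /= ffunE; exact: hc.
  case=> q Bq; apply: eA => i; have := Bq i; rewrite /= ffunE => h1.
  rewrite (le_lt_trans (ler_distD (ratr (c i)) _ _))// (splitr e) ltrD//.
    exact: lt_trans ke.
  by rewrite distrC (lt_trans _ ke).
apply: countable_bigcupT_measurable => // x.
by case: asboolP => // _; exact: mB.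
Qed.

Lemma measurable_fun_open d (S : measurableType d) (D : set S) (g : S -> R) :
  (forall r, measurable (D `&` [set x | r < g x])) -> measurable_fun D g.
Proof.
move=> mg mD; apply: (measurability _ (RGenOInfty.measurableE R)) => //.
move=> _ [_ [r ->] <-]; have := mg r; congr (measurable (_ `&` _)).
by apply/seteqP; split => x /=; rewrite in_itv/= andbT.
Qed.

End OpenMeasurable.

Section Coordinates.
Variables (R : realType) (n : nat).
Local Notation C := R[i].
Local Notation T := (measurableTypeR R).
Local Notation m := #|upper n|.
Local Notation coords := ((n + n).-tuple T * (m + m).-tuple T)%type.

Definition coord_pt (p : coords) : coordSpace R n := (cvec p.1, cvec p.2).

Lemma measurable_coord1 i : measurable_fun setT (fun p : coords => tnth p.1 i).
Proof. exact: (measurableT_comp (measurable_tnth i) measurable_fst). Qed.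

Lemma measurable_coord2 i : measurable_fun setT (fun p : coords => tnth p.2 i).
Proof. exact: (measurableT_comp (measurable_tnth i) measurable_snd). Qed.

Lemma norm_lt_complex (e : R) (x : C) :
  `|complex.Re x| < e -> `|complex.Im x| < e -> `|x| < (e + e)%:C.
Proof.
case: x => a b /= hr hi; have -> : a +i* b = a%:C + (0 +i* b) by simpc.
rewrite (le_lt_trans (ler_normD _ _))// rmorphD !normc_def /=.
by rewrite expr0n addr0 add0r !sqrtr_sqr ltrD// ltcR.
Qed.

(** The bridge between [coordSpace], where holomorphy is stated, and the tuples of reals, where the
    integrals are taken. *)
Lemma open_coord_measurable (A : set (coordSpace R n)) : open A ->
  measurable (coord_pt @^-1` A).
Proof.
move=> Aop; apply: (@box_open_measurable R _ _ ('I_(n + n) + 'I_(m + m))%type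
  (fun i p => match i with inl i => tnth p.1 i | inr i => tnth p.2 i end)).
  by case=> i; [exact: measurable_coord1|exact: measurable_coord2].
move=> p /= Ap; have /nbhs_ballP[e /= e0 eA] : nbhs (coord_pt p) A.
  exact: open_nbhs_nbhs.
have [r r0 re] := gt0_real e0.
exists (r / 2); first by rewrite divr_gt0.
move=> q hq; apply: eA; rewrite re (splitr r).
split => /=; split; rewrite ?rmorphD ?addr_gt0 ?ltcR ?divr_gt0// => i j;
  rewrite /ball /= !mxE -rmorphD; apply: norm_lt_complex => /=.
- by have := hq (inl (lshift n i)); rewrite distrC.
- by have := hq (inl (rshift n i)); rewrite distrC.
- by have := hq (inr (lshift m i)); rewrite distrC.
- by have := hq (inr (rshift m i)); rewrite distrC.
Qed.

End Coordinates.

(** * Limits of matrices *)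

Section MatrixLimits.
Variables (K : numFieldType) (S : Type) (F : set_system S).
Hypothesis FF : Filter F.

Lemma cvg_sum_seq I (r : seq I) (f : I -> S -> K) (a : I -> K) :
  (forall i, f i x @[x --> F] --> a i) ->
  \sum_(i <- r) f i x @[x --> F] --> \sum_(i <- r) a i.
Proof.
move=> fa; elim: r => [|i r IH].
  by rewrite big_nil; under eq_fun do rewrite big_nil; exact: cvg_cst.
by rewrite big_cons; under eq_fun do rewrite big_cons; exact: cvgD.
Qed.

Lemma cvg_prod_seq I (r : seq I) (f : I -> S -> K) (a : I -> K) :
  (forall i, f i x @[x --> F] --> a i) ->
  \prod_(i <- r) f i x @[x --> F] --> \prod_(i <- r) a i.
Proof.
move=> fa; elim: r => [|i r IH].
  by rewrite big_nil; under eq_fun do rewrite big_nil; exact: cvg_cst.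
by rewrite big_cons; under eq_fun do rewrite big_cons; exact: cvgM.
Qed.

Definition mxcvg p q (A : S -> 'M[K]_(p, q)) (A0 : 'M[K]_(p, q)) :=
  forall i j, A x i j @[x --> F] --> A0 i j.

Lemma mxcvg_cst p q (A0 : 'M[K]_(p, q)) : mxcvg (fun=> A0) A0.
Proof. by move=> i j; exact: cvg_cst. Qed.

Lemma mxcvgD p q (A B : S -> 'M[K]_(p, q)) A0 B0 :
  mxcvg A A0 -> mxcvg B B0 -> mxcvg (fun x => A x + B x) (A0 + B0).
Proof.
move=> cA cB i j; rewrite mxE; under eq_fun do rewrite mxE.
exact: cvgD.
Qed.

Lemma mxcvgN p q (A : S -> 'M[K]_(p, q)) A0 :
  mxcvg A A0 -> mxcvg (fun x => - A x) (- A0).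
Proof.
by move=> cA i j; rewrite mxE; under eq_fun do rewrite mxE; exact: cvgN.
Qed.

Lemma mxcvgM p q r (A : S -> 'M[K]_(p, q)) (B : S -> 'M[K]_(q, r)) A0 B0 :
  mxcvg A A0 -> mxcvg B B0 -> mxcvg (fun x => A x *m B x) (A0 *m B0).
Proof.
move=> cA cB i j; rewrite mxE; under eq_fun do rewrite mxE.
by apply: cvg_sum_seq => k; exact: cvgM.
Qed.

Lemma cvg_det n (A : S -> 'M[K]_n) A0 :
  mxcvg A A0 -> \det (A x) @[x --> F] --> \det A0.
Proof.
move=> cA; apply: cvg_sum_seq => s; apply: cvgM; first exact: cvg_cst.
by apply: cvg_prod_seq => i; exact: cA.
Qed.

Lemma mxcvg_adj n (A : S -> 'M[K]_n) A0 :
  mxcvg A A0 -> mxcvg (fun x => \adj (A x)) (\adj A0).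
Proof.
move=> cA i j; rewrite mxE; under eq_fun do rewrite mxE.
apply: cvgM; first exact: cvg_cst.
apply: cvg_det => k l; rewrite !mxE; under eq_fun do rewrite !mxE.
exact: cA.
Qed.

Lemma near_unitmx n (A : S -> 'M[K]_n) A0 :
  mxcvg A A0 -> A0 \in unitmx -> \forall x \near F, A x \in unitmx.
Proof.
rewrite unitmxE unitfE => cA A0u; have := @cvgr_neq0 _ _ _ _ FF _ _ (cvg_det cA) A0u.
by apply: filterS => x; rewrite unitmxE unitfE.
Qed.

(** Cramer's rule expresses the inverse by continuous functions, but only where the matrix is
    invertible: elsewhere [invmx] returns its argument. Hence the appeal to invertibility near the
    limit. *)
Lemma mxcvgV n (A : S -> 'M[K]_n) A0 :
  mxcvg A A0 -> A0 \in unitmx -> mxcvg (fun x => invmx (A x)) (invmx A0).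
Proof.
move=> cA A0u i j; have Au := near_unitmx cA A0u.
have : (\det (A x))^-1 * \adj (A x) i j @[x --> F] --> invmx A0 i j.
  rewrite /invmx A0u scalemxE; apply: cvgM; last exact: mxcvg_adj.
  by apply: cvgV; [rewrite -unitfE -unitmxE | exact: cvg_det].
apply: cvg_trans; apply: near_eq_cvg; apply: filterS Au => x ux.
by rewrite /invmx ux scalemxE.
Qed.

End MatrixLimits.

Section ComplexLimits.
Variables (R : realType) (S : Type) (F : set_system S).
Hypothesis FF : Filter F.
Local Notation C := R[i].

Lemma cvg_conjc (f : S -> C^o) (a : C^o) :
  f x @[x --> F] --> a -> ((f x)^*%C : C^o) @[x --> F] --> (a^*%C : C^o).
Proof.
move=> /cvgrPdist_lt fa; apply/cvgrPdist_lt => e e0.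
by apply: filterS (fa e e0) => x; rewrite -rmorphB /= normcJ.
Qed.

Lemma mxcvg_cbar p q (A : S -> 'M[C]_(p, q)) A0 :
  mxcvg F A A0 -> mxcvg F (fun x => cbar (A x)) (cbar A0).
Proof.
move=> cA i j; rewrite mxE; under eq_fun do rewrite mxE.
by apply: cvg_conjc; exact: cA.
Qed.

Lemma cvg_Re (f : S -> C^o) (a : C^o) :
  f x @[x --> F] --> a -> complex.Re (f x) @[x --> F] --> complex.Re a.
Proof.
move=> /cvgrPdist_lt fa; apply/cvgrPdist_lt => e e0.
have := fa e%:C; rewrite ltcR => /(_ e0); apply: filterS => x.
by rewrite -ltcR -raddfB; apply: le_lt_trans; exact: normc_ge_Re.
Qed.

Lemma normc_ge_Im (x : C) : `|complex.Im x|%:C <= `|x|.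
Proof.
by case: x => a b; rewrite normc_def lecR /= -sqrtr_sqr ler_wsqrtr// lerDr sqr_ge0.
Qed.

Lemma cvg_Im (f : S -> C^o) (a : C^o) :
  f x @[x --> F] --> a -> complex.Im (f x) @[x --> F] --> complex.Im a.
Proof.
move=> /cvgrPdist_lt fa; apply/cvgrPdist_lt => e e0.
have := fa e%:C; rewrite ltcR => /(_ e0); apply: filterS => x.
by rewrite -ltcR -raddfB; apply: le_lt_trans; exact: normc_ge_Im.
Qed.

End ComplexLimits.

(** * Openness of positive definiteness *)

Section PosdefOpen.
Variables (R : realType) (n : nat).
Local Notation C := R[i].
Implicit Types (A E W : 'M[C]_n) (v w : 'cV[C]_n).

Lemma ge0_real (a : C) : 0 <= a -> exists2 r : R, 0 <= r & a = r%:C.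
Proof.
case: a => r s; rewrite lecE /= => /andP[/eqP -> r0].
by exists r.
Qed.

Lemma Re_le_norm (z : C) (r : R) : `|z| <= r%:C -> - r <= complex.Re z <= r.
Proof.
move=> zr; rewrite -ler_norml -lecR.
exact: le_trans (normc_ge_Re z) zr.
Qed.

Lemma dotp_herm_conj A v w : A^T = cbar A -> dotp (A *m v) w = dotp v (A *m w).
Proof. by move=> Ah; rewrite dotpMr -Ah trmxK. Qed.

Lemma dotp_norm v : dotp v v = \sum_i `|v i 0| ^+ 2.
Proof. by rewrite dotpE; apply: eq_bigr => i _; rewrite sqr_normc mulrC. Qed.

Lemma normM_le (K : numFieldType) (a b : K) : 0 <= a -> 0 <= b ->
  a * b <= (a ^+ 2 + b ^+ 2) / 2.
Proof.
move=> a0 b0; rewrite ler_pdivlMr// -subr_ge0.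
have -> : a ^+ 2 + b ^+ 2 - a * b * 2 = (a - b) ^+ 2 by ring.
by rewrite real_exprn_even_ge0// realB// ger0_real.
Qed.

(** Each product |v_i| |v_j| is at most (|v_i|^2 + |v_j|^2) / 2; the sum of these bounds over all
    pairs is n |v|^2. *)
Lemma form_bound (e : C) E v : 0 <= e -> (forall i j, `|E i j| <= e) ->
  `|dotp v (E *m v)| <= e * n%:R * dotp v v.
Proof.
move=> e0 Ee; rewrite dotp_norm dotpE.
have -> : e * n%:R * (\sum_i `|v i 0| ^+ 2) =
  \sum_(i < n) \sum_(j < n) e * ((`|v i 0| ^+ 2 + `|v j 0| ^+ 2) / 2).
  under [RHS]eq_bigr do
    rewrite -mulr_sumr -mulr_suml big_split /= sumr_const card_ord.
  rewrite -mulr_sumr -mulr_suml big_split /= sumr_const card_ord sumrMnl.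
  by rewrite -mulr2n -[_ *+ 2]mulr_natr mulfK ?pnatr_eq0// -mulrA mulr_natl.
rewrite (le_trans (ler_norm_sum _ _ _))// ler_sum// => i _.
rewrite normrM normcJ mxE.
rewrite (le_trans (ler_wpM2l _ (ler_norm_sum _ _ _)))// mulr_sumr ler_sum// => j _.
rewrite normrM mulrCA ler_pM ?mulr_ge0//.
exact: normM_le.
Qed.

(** A coercivity constant obtained without compactness or spectral theory. With w = A^-1 v and s =
    1/K, where K bounds the form of A^-1, positivity at v - s w reads 0 <= <v, A v> - 2 s |v|^2 +
    s^2 <w, v>, and the last term is at most s |v|^2. *)
Lemma posdef_bound A : posdef A -> A \in unitmx ->
  exists2 k : R, 0 < k & forall v, k%:C * dotp v v <= dotp v (A *m v).
Proof.
move=> [Ah Apos] uA; set M := invmx A.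
(* The sum of the moduli bounds every entry of the inverse; the added 1 makes K positive even if
   that sum, or n, is zero. *)
pose K : C := (\sum_i \sum_j `|M i j|) * n%:R + 1.
have S0 : 0 <= \sum_i \sum_j `|M i j| by do 2 rewrite sumr_ge0// => ? _.
have K0 : 0 < K by rewrite ltr_wpDl// mulr_ge0.
have MK v : `|dotp v (M *m v)| <= K * dotp v v.
  apply: (le_trans (form_bound v S0 _)).
    move=> i j; rewrite (bigD1 i)//= (bigD1 j)//= -addrA lerDl addr_ge0//.
      by rewrite sumr_ge0.
    by rewrite sumr_ge0// => k _; rewrite sumr_ge0.
  by rewrite ler_wpM2r ?dotp_ge0// lerDl.
have [s s0 sE] : exists2 s : R, 0 < s & K^-1 = s%:C.
  by apply/gt0_real; rewrite invr_gt0.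
exists s => // v; set w := M *m v.
have Aw : A *m w = v by rewrite /w mulmxA mulmxV// mul1mx.
have : 0 <= dotp (v - s%:C *: w) (A *m (v - s%:C *: w)).
  have [->|x0] := eqVneq (v - s%:C *: w) 0; last exact/ltW/Apos.
  by rewrite mulmx0 dotpE sumr_ge0// => i _; rewrite mxE mulr0.
rewrite mulmxBr -scalemxAr Aw !dotpBl !dotpBr !dotpZl !dotpZr conjc_real.
rewrite -(dotp_herm_conj w v Ah) Aw.
have [q q0 qE] := ge0_real (dotp_ge0 v).
have : 0 <= dotp v (A *m v).
  have [->|v0] := eqVneq v 0; last exact/ltW/Apos.
  by rewrite mulmx0 dotpE sumr_ge0// => i _; rewrite mxE mulr0.
move=> /ge0_real[a a0 aE].
have := MK v; rewrite -/w -[K]invrK sE qE -fmorphV -rmorphM /= => vw.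
have : `|dotp w v| <= (s^-1 * q)%:C by rewrite dotpC normcJ.
move=> /Re_le_norm/andP[_]; rewrite aE -rmorphM lecR.
rewrite mulrC ler_pdivlMr//.
case: (dotp w v) => x y /= xq.
rewrite lecE => /andP[_]; simpc => /=.
have := ler_wpM2r (ltW s0) xq; lra.
Qed.

(** Entries moved by less than k/(n+1) change the form by at most k n/(n+1) |v|^2, strictly less
    than the lower bound k |v|^2. *)
Lemma posdef_open A : posdef A -> A \in unitmx ->
  exists2 e : R, 0 < e & forall A', A'^T = cbar A' ->
    (forall i j, `|A' i j - A i j| < e%:C) -> posdef A'.
Proof.
move=> Apd uA; have [k k0 kA] := posdef_bound Apd uA.
have n1 : 0 < n.+1%:R :> R by rewrite ltr0n.
exists (k / n.+1%:R); first by rewrite divr_gt0.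
move=> A' A'h A'e; split=> // v v0; have vv := dotp_gt0 v0.
have dE : dotp v (A' *m v) = dotp v (A *m v) + dotp v ((A' - A) *m v).
  by rewrite -dotpDr -mulmxDl subrKC.
have e0 : 0 <= (k / n.+1%:R)%:C by rewrite ler0c ltW// divr_gt0.
have Eb i j : `|(A' - A) i j| <= (k / n.+1%:R)%:C.
  by rewrite addmxE oppmxE ltW.
have := form_bound v e0 Eb; have := kA v; have [q q0 qE] := gt0_real vv.
(* The order on complex numbers makes positivity include reality, which comes from A' being
   Hermitian. *)
have : (dotp v (A' *m v))^*%C = dotp v (A' *m v).
  by rewrite -dotpC dotp_herm_conj.
rewrite dE qE -(rmorph_nat (real_complex R)) -!rmorphM /=.
case: (dotp v (A *m v)) => a a'; case: (dotp v _) => b b'.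
move=> xr ka /Re_le_norm/andP[kb _].
move: ka; rewrite lecE => /andP[_ /= ka].
rewrite ltcE /=; apply/andP; split.
  by move: xr => /eqP; rewrite eq_complex /= => /andP[_] /eqP; lra.
rewrite /= in kb.
have : k / n.+1%:R * n%:R * q < k * q.
  by rewrite ltr_pM2r// mulrAC ltr_pdivrMr// ltr_pM2l// ltr_nat.
by move: kb; set t := k / _ * _ * _; lra.
Qed.

End PosdefOpen.

Section BallOpen.
Variables (R : realType) (n : nat).
Local Notation C := R[i].
Local Notation T := (measurableTypeR R).
Local Notation m := #|upper n|.
Local Notation coords := ((n + n).-tuple T * (m + m).-tuple T)%type.

Lemma dsym_tr (p q : 'I_n) : (dsym R p q)^T = dsym R p q.
Proof.
apply/matrixP => i j; rewrite !mxE (eq_sym j i).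
have [->|_] := eqVneq i j; first by ring.
by rewrite !mul0r; ring.
Qed.

Lemma symmx_tr (w : 'cV[C]_m) : (symmx w)^T = symmx w.
Proof.
rewrite /symmx raddf_sum; apply: eq_bigr => p _.
by rewrite -[in RHS]dsym_tr; apply/matrixP => i j; rewrite !mxE.
Qed.

Lemma siegel_herm (W : 'M[C]_n) : W^T = W ->
  (1%:M - W *m cbar W)^T = cbar (1%:M - W *m cbar W).
Proof.
by move=> WT; rewrite trmxB cbarB trmx_mul cbarM cbarK trmx1 cbar1 -cbarT WT.
Qed.

Definition ball_pt : set (coordSpace R n) := [set p | siegel_ball (symmx p.2)].

Lemma mxcvg_symmx (p : coordSpace R n) :
  mxcvg (nbhs p) (fun q : coordSpace R n => symmx q.2) (symmx p.2).
Proof.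
move=> i j; rewrite /symmx summxE; under eq_fun do rewrite summxE.
apply: cvg_sum_seq => k; rewrite mxE; under eq_fun do rewrite mxE.
apply: cvgM; last exact: cvg_cst.
apply: (@cvg_comp _ _ _ (fun q : coordSpace R n => q.2) (fun w => w (enum_rank k) 0)
  _ (nbhs p.2)); first exact: cvg_snd.
exact: coord_continuous.
Qed.

(** Symmetry is built into [symmx], so only positivity has to survive a perturbation; it does
    because the finitely many entries of 1 - W conj(W) are continuous. *)
Lemma open_ball_pt : open ball_pt.
Proof.
rewrite openE => p [_ pD]; have uA : 1%:M - symmx p.2 *m cbar (symmx p.2) \in unitmx.
  by apply: siegel_unit1; split; rewrite ?symmx_tr.
have [e e0 eA] := posdef_open pD uA.
have cA : mxcvg (nbhs p)
    (fun q : coordSpace R n => 1%:M - symmx q.2 *m cbar (symmx q.2))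
    (1%:M - symmx p.2 *m cbar (symmx p.2)).
  apply: mxcvgD; first exact: mxcvg_cst; apply: mxcvgN; apply: mxcvgM.
    exact: mxcvg_symmx.
  by apply: mxcvg_cbar; exact: mxcvg_symmx.
have e0' : 0 < e%:C by rewrite ltcR.
pose close (ij : 'I_n * 'I_n) (q : coordSpace R n) :=
  `|(1%:M - symmx p.2 *m cbar (symmx p.2)) ij.1 ij.2 -
    (1%:M - symmx q.2 *m cbar (symmx q.2)) ij.1 ij.2| < e%:C.
have pclose : nbhs p [set q | forall ij, close ij q].
  have closeE ij : nbhs p [set q | close ij q].
    by have /cvgrPdist_lt := cA ij.1 ij.2; apply.
  exact: (@filter_forall (coordSpace R n) _ (fun ij => [set q | close ij q])
    (nbhs p) (nbhs_filter p) closeE).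
apply: filterS pclose => q hq; split; first by rewrite symmx_tr.
apply: eA; first by apply: siegel_herm; rewrite symmx_tr.
by move=> i j; rewrite distrC; exact: (hq (i, j)).
Qed.

Lemma measurable_ball_coords : measurable (@ball_coords R n).
Proof. exact: (open_coord_measurable open_ball_pt). Qed.

Lemma measurable_fun_continuous (D : set (coordSpace R n))
    (g : coordSpace R n -> R) : open D ->
  (forall p, D p -> g q @[q --> p] --> g p) ->
  measurable_fun (@coord_pt R n @^-1` D) (g \o @coord_pt R n).
Proof.
move=> Dop gc; apply: measurable_fun_open => r.
have -> : @coord_pt R n @^-1` D `&` [set x | r < (g \o @coord_pt R n) x] =
  @coord_pt R n @^-1` (D `&` [set q | r < g q]) by [].
apply: open_coord_measurable; rewrite openE => p [pD rp].
apply: filterI; first exact: open_nbhs_nbhs (conj Dop pD).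
by have := gc p pD; move/cvgr_gt; apply.
Qed.

Lemma holomorphic_measurable (f : 'cV[C]_n -> 'M[C]_n -> C) :
  holomorphic f ->
  measurable_fun (@ball_coords R n) (fun p => complex.Re (integrand f p)) /\
  measurable_fun (@ball_coords R n) (fun p => complex.Im (integrand f p)).
Proof.
move=> fh; have fc p : ball_pt p ->
    (f q.1 (symmx q.2) : C^o) @[q --> p] --> (f p.1 (symmx p.2) : C^o).
  by move=> /fh /differentiable_continuous.
split.
- apply: (@measurable_fun_continuous ball_pt
    (fun q => complex.Re (f q.1 (symmx q.2))) open_ball_pt).
  by move=> p /fc; exact: cvg_Re.
- apply: (@measurable_fun_continuous ball_pt
    (fun q => complex.Im (f q.1 (symmx q.2))) open_ball_pt).
  by move=> p /fc; exact: cvg_Im.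
Qed.

End BallOpen.

(** * Change of variables in the scalar product *)

Section ChangeFC.
Variables (R : realType) (n : nat).
Local Notation C := R[i].
Local Notation T := (measurableTypeR R).
Local Notation m := #|upper n|.
Local Notation coords := ((n + n).-tuple T * (m + m).-tuple T)%type.
Local Notation ball := (@ball_coords R n).

Definition FCw (w : (m + m).-tuple T) : 'M[R]_(n + n) := FCmx (symmx (cvec w)).

Definition FCcoords (p : coords) : coords := (aff (FCw p.2) 0 p.1, p.2).

Lemma zof_FCcoords p : zof (FCcoords p) = FC (zof p) (Wof p).
Proof.
rewrite /zof /Wof /= -[cvec p.1]/(cpair (tnth p.1)) -FCmx_cpair.
by apply/matrixP => i j; rewrite !mxE !tnth_mktuple !mxE !addr0.
Qed.

Lemma cvg_FCmx (q : coordSpace R n) :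
  mxcvg (nbhs q) (fun q : coordSpace R n => FCmx (symmx q.2))
    (FCmx (symmx q.2)).
Proof.
have cW := @mxcvg_symmx R n q.
have cRe : mxcvg (nbhs q) (fun q : coordSpace R n => Re_mx (symmx q.2))
    (Re_mx (symmx q.2)).
  move=> i j; rewrite mxE; under eq_fun do rewrite mxE.
  by apply: cvg_Re; exact: cW.
have cIm : mxcvg (nbhs q) (fun q : coordSpace R n => - Im_mx (symmx q.2))
    (- Im_mx (symmx q.2)).
  apply: mxcvgN => i j; rewrite mxE; under eq_fun do rewrite mxE.
  by apply: cvg_Im; exact: cW.
move=> i j; rewrite -(splitK i) -(splitK j) /unsplit /FCmx.
case: (fintype.split i) => k; case: (fintype.split j) => l.
- rewrite block_mxEul; under eq_fun do rewrite block_mxEul.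
  by apply: mxcvgD; [exact: mxcvg_cst|exact: mxcvgN].
- rewrite block_mxEur; under eq_fun do rewrite block_mxEur.
  exact: cIm.
- rewrite block_mxEdl; under eq_fun do rewrite block_mxEdl.
  exact: cIm.
- rewrite block_mxEdr; under eq_fun do rewrite block_mxEdr.
  by apply: mxcvgD; [exact: mxcvg_cst|].
Qed.

Lemma measurable_FCw i j : measurable_fun setT (fun p : coords => FCw p.2 i j).
Proof.
apply: (@measurable_fun_continuous R n setT
  (fun q => FCmx (symmx q.2) i j) openT).
by move=> q _; exact: cvg_FCmx.
Qed.

Lemma measurable_det_FCw : measurable_fun setT (fun p : coords => \det (FCw p.2)).
Proof.
apply: (@measurable_fun_continuous R n setT
  (fun q => \det (FCmx (symmx q.2))) openT).
by move=> q _; apply: cvg_det; exact: cvg_FCmx.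
Qed.

Lemma measurable_FCcoords : measurable_fun setT FCcoords.
Proof.
apply/measurable_fun_pair => //=; apply: measurable_tuple => i.
apply: measurable_funD => //; apply: measurable_sum => j.
by apply: measurable_funM; [exact: measurable_FCw|exact: measurable_coord1].
Qed.

Local Open Scope ereal_scope.

(** Tonelli puts W outside; for each W in the ball the inner integral is a linear change of
    variables with matrix [FCw]. Extension by zero allows integration over the whole product space
    and hides the determinants at points off the ball, whose sign is not controlled. *)
Lemma integral_FCcoords (h : coords -> \bar R) : measurable_fun ball h ->
  (forall p, ball p -> 0 <= h p) ->
  \int[volume R n]_(p in ball) h p =
  \int[volume R n]_(p in ball) (h (FCcoords p) * (\det (FCw p.2))%:E).
Proof.
move=> mh h0; have mD := @measurable_ball_coords R n.
pose H := h \_ ball.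
have mH : measurable_fun setT H by apply/(measurable_restrictT _ mD).
have H0 p : 0 <= H p.
  by rewrite /H /patch; case: ifPn => // /set_mem /h0.
have HN p : ~ ball p -> H p = 0.
  by move=> pD; rewrite /H /patch memNset.
pose K p := H (FCcoords p) * (\det (FCw p.2))%:E.
have det0 (p : coords) : ball p -> (0 < \det (FCw p.2))%R.
  by move=> pD; apply: pos_form_det; exact: FCmx_pos.
have K0 p : 0 <= K p.
  rewrite /K; have [pD|pD] := pselect (ball p); last by rewrite HN// mul0e.
  by rewrite mule_ge0// lee_fin ltW// det0.
have mK : measurable_fun setT K.
  apply: emeasurable_funM.
    by apply: measurableT_comp => //; exact: measurable_FCcoords.
  by apply/measurable_EFinP; exact: measurable_det_FCw.
rewrite integral_mkcond [RHS]integral_mkcond -/H.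
have -> : (fun p => h (FCcoords p) * (\det (FCw p.2))%:E) \_ ball = K.
  apply/funext => p; rewrite /K /H /patch.
  (* Membership in the ball depends only on the second component, which [FCcoords] leaves fixed, so
     the two conditions are convertible. *)
  by rewrite -[FCcoords p \in ball]/(p \in ball); case: ifPn => // _; rewrite mul0e.
rewrite /volume /=.
rewrite (fubini_tonelli2 H mH H0) (fubini_tonelli2 K mK K0).
apply: eq_integral => w _; rewrite /fubini_G.
have [wD|wD] := pselect (siegel_ball (symmx (cvec w) : 'M[C]_n)); last first.
  rewrite !integral0_eq// => z _; last by rewrite HN.
  by rewrite /K HN// mul0e.
have mHw : measurable_fun setT (fun z : (n + n).-tuple T => H (z, w)).
  exact: (measurableT_comp mH (measurable_pair2 w)).
have dw : (0 < \det (FCw w))%R by exact: (det0 ([tuple 0%R | _ < _], w)).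
pose Hw z := H (z, w); have Hw0 z : 0 <= Hw z by exact: H0.
rewrite -[LHS]/(\int[leb R (n + n)]_z Hw z).
rewrite -[RHS]/(\int[leb R (n + n)]_z
  (Hw (aff (FCw w) 0 z) * (\det (FCw w))%:E)).
have mHa : measurable_fun setT (fun z => Hw (aff (FCw w) 0 z)).
  exact: (measurableT_comp (mHw : measurable_fun setT Hw)
    (measurable_aff (FCw w) 0)).
rewrite (ge0_integralZr _ measurableT mHa (fun z _ => Hw0 _)); last first.
  by rewrite lee_fin ltW.
rewrite (integral_aff 0 (FCmx_pos wD) mHw Hw0).
by rewrite muleAC -EFinM mulVf ?gt_eqF// mul1e.
Qed.

End ChangeFC.

(** * The inverse of the FC transform and the two densities *)

Section Inverse.
Variables (R : realType) (n : nat).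
Local Notation C := R[i].
Implicit Types (W : 'M[C]_n) (z eta : 'cV[C]_n).

Definition FCinv z W : 'cV[C]_n := Mmx W *m (z + W *m cbar z).

Lemma cbar_Mmx W : W^T = W -> 1%:M - W *m cbar W \in unitmx ->
  cbar (Mmx W) = invmx (1%:M - cbar W *m W).
Proof.
move=> WT uA; have uB : 1%:M - cbar W *m W \in unitmx.
  by rewrite -(map_unitmx Num.conj) -/(cbar _) cbarB cbar1 cbarM cbarK in uA *.
apply: (can_inj (mulKmx uB)); rewrite mulmxV//.
have -> : 1%:M - cbar W *m W = cbar (1%:M - W *m cbar W).
  by rewrite cbarB cbar1 cbarM cbarK.
by rewrite -cbarM mulmxV// cbar1.
Qed.

(** The relation (1 - W conj(W)) W = W (1 - conj(W) W) moves the inverse across W. What remains is M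
    applied to z + W conj(z) - W conj(z) - W conj(W) z, which is z. *)
Lemma FC_FCinv z W : W^T = W -> 1%:M - W *m cbar W \in unitmx ->
  FC (FCinv z W) W = z.
Proof.
move=> WT uA; have := cbar_Mmx WT uA.
rewrite /FC /FCinv cbarM cbarD cbarM cbarK => ->.
set A := 1%:M - _ in uA *; set B := 1%:M - _.
have uB : B \in unitmx.
  by rewrite -(map_unitmx Num.conj) -/(cbar _) cbarB cbar1 cbarM cbarK.
have AW : A *m W = W *m B by rewrite mulmxBl mulmxBr mul1mx mulmx1 mulmxA.
have WB : W *m invmx B = invmx A *m W.
  apply: (can_inj (mulKmx uA)); rewrite mulKVmx// mulmxA AW.
  by rewrite -mulmxA mulmxV// mulmx1.
rewrite -[Mmx W]/(invmx A) (mulmxA W (invmx B)) WB -(mulmxA (invmx A)) -mulmxBr.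
rewrite (mulmxDr W) (mulmxA W (cbar W)).
rewrite opprD addrA addrK.
have -> : z - W *m cbar W *m z = A *m z by rewrite mulmxBl mul1mx.
by rewrite mulKmx.
Qed.

Lemma calFdiag_real eta W : exists r : R, calFdiag eta W = r%:C.
Proof.
have cE (A : 'M[C]_1) : (A 0 0)^*%C = cbar A 0 0 by rewrite mxE.
rewrite /calFdiag !mxlinE.
set a := _ 0 0; set b := _ 0 0; set c := _ 0 0.
have [r _ aE] : exists2 r : R, 0 <= r & a = r%:C.
  by apply: ge0_real; exact: dotp_ge0.
(* The two quadratic terms are conjugate to each other, so half their sum is the real part of
   either. *)
have cb : c = b^*%C by rewrite /b cE !cbarM !cbarT !cbarK.
exists (r - complex.Re b).
by rewrite aE cb rmorphB /= ReJ_add -addrA -opprD -mulrDr mulrC.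
Qed.

Lemma Fdiag_real z W : siegel_ball W -> exists r : R, Fdiag z W = r%:C.
Proof.
move=> WD; rewrite -(FC_FCinv z (siegel_sym WD) (siegel_unit1 WD)).
rewrite Fdiag_FC ?siegel_unit1// ?siegel_sym//; exact: calFdiag_real.
Qed.

Lemma rho1_gt0 k z W : siegel_ball W -> exists2 r : R, 0 < r & rho1 k z W = r%:C.
Proof.
move=> WD; have [d d0 dE] := gt0_real (siegel_det_inv_gt0 WD).
have [F FE] := Fdiag_real z WD.
rewrite /rho1 dE FE cpow_real// -rmorphN cexp_real -rmorphM /=.
by eexists; last by []; rewrite mulr_gt0 ?expR_gt0.
Qed.

(** The factor det(1 - W conj(W)) is the Jacobian of FC at fixed W; it accounts for the shift by one
    in the exponent. *)
Lemma rho2_rho1 k eta W : siegel_ball W ->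
  rho2 k eta W = rho1 k (FC eta W) W * \det (1%:M - W *m cbar W).
Proof.
move=> WD; have [d d0 dE] := gt0_real (siegel_det_inv_gt0 WD).
rewrite /rho1 /rho2 Fdiag_FC ?siegel_unit1// ?siegel_sym// dE.
rewrite [RHS]mulrAC cpowM_self//.
by congr (cpow _ _ * _); ring.
Qed.

End Inverse.

(** * Integrability and transfer of the complex integrals *)

Section Integrals.
Variables (R : realType) (n : nat).
Local Notation C := R[i].
Local Notation T := (measurableTypeR R).
Local Notation m := #|upper n|.
Local Notation coords := ((n + n).-tuple T * (m + m).-tuple T)%type.
Local Notation ball := (@ball_coords R n).
Local Notation mu := (volume R n).

Section RealIntegrand.
Variables u v : coords -> R.
Hypothesis uv : forall p, ball p -> v p = u (FCcoords p) * \det (FCw p.2).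
Hypothesis mu_u : measurable_fun ball u.

Let mD := @measurable_ball_coords R n.

Lemma det_FCw_gt0 (p : coords) : ball p -> 0 < \det (FCw p.2).
Proof. by move=> pD; apply: pos_form_det; exact: FCmx_pos. Qed.

Lemma measurable_FC_integrand : measurable_fun ball v.
Proof.
apply: (@eq_measurable_fun _ _ _ _ ball
  (fun p => u (FCcoords p) * \det (FCw p.2))).
  by move=> p /set_mem pD; rewrite uv.
apply: measurable_funM; last exact: (measurable_funTS (@measurable_det_FCw R n)).
apply: (measurable_comp mD) => //; last first.
  exact: (measurable_funTS (@measurable_FCcoords R n)).
by move=> _ [p pD <-].
Qed.

Lemma integrable_FC : mu.-integrable ball (EFin \o u) ->
  mu.-integrable ball (EFin \o v).
Proof.
move=> /integrableP[_ uoo]; apply/integrableP; split.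
  by apply/measurable_EFinP; exact: measurable_FC_integrand.
move: uoo; rewrite (@integral_FCcoords R n (fun p => `|(EFin \o u) p|)%E)//.
  congr (_ < _)%E; apply: eq_integral => p /set_mem pD.
  by rewrite /= uv// normrM EFinM (gtr0_norm (det_FCw_gt0 pD)).
by apply: measurableT_comp => //; apply/measurable_EFinP.
Qed.

(** The change of variables holds for nonnegative functions, so it is applied to the positive and
    negative parts; the positive Jacobian factors out of both. *)
Lemma Rintegral_FC : \int[mu]_(p in ball) u p = \int[mu]_(p in ball) v p.
Proof.
rewrite /Rintegral; congr fine; rewrite integralE [RHS]integralE.
have mEu : measurable_fun ball (EFin \o u) by apply/measurable_EFinP.
congr (_ - _)%E.
- rewrite (@integral_FCcoords R n (EFin \o u)^\+%E).
  + apply: eq_integral => p /set_mem pD; rewrite !funeposE /= uv// EFinM.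
    by rewrite maxe_pMl ?mul0e// lee_fin ltW// det_FCw_gt0.
  + exact: measurable_funepos.
  + by move=> p _; exact: funepos_ge0.
- rewrite (@integral_FCcoords R n (EFin \o u)^\-%E).
  + apply: eq_integral => p /set_mem pD; rewrite !funenegE /= uv// -mulNr EFinM.
    by rewrite maxe_pMl ?mul0e// lee_fin ltW// det_FCw_gt0.
  + exact: measurable_funeneg.
  + by move=> p _; exact: funeneg_ge0.
Qed.

End RealIntegrand.

Variable k : R.
Implicit Types f g : 'cV[C]_n -> 'M[C]_n -> C.

Definition herm_density f g z W : C := (f z W)^* * g z W * rho1 k z W.

Lemma herm_density_FC f g p : ball p ->
  integrand (fun eta W => (f (FC eta W) W)^* * g (FC eta W) W * rho2 k eta W) p =
  integrand (herm_density f g) (FCcoords p) * (\det (FCw p.2))%:C.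
Proof.
move=> pD; rewrite /integrand /herm_density zof_FCcoords rho2_rho1// mulrA.
by rewrite det_FCmx.
Qed.

Lemma Re_scale (x : C) (r : R) : complex.Re (x * r%:C) = complex.Re x * r.
Proof. by case: x => a b /=; rewrite mulr0 subr0. Qed.

Lemma Im_scale (x : C) (r : R) : complex.Im (x * r%:C) = complex.Im x * r.
Proof. by case: x => a b /=; rewrite mulr0 add0r. Qed.

(** Domination is by |f|^2 rho_1 + |g|^2 rho_1. Measurability of the mixed integrand is drawn from
    that of |f|^2 rho_1: dividing by |f|^2 and multiplying by the real or imaginary part of conj(f)
    g, which is continuous on the ball, gives the components. *)
Lemma integrable_herm_density f g : in_hilbert k f -> in_hilbert k g ->
  SJ_integrable (herm_density f g).
Proof.
move=> [fh [fi _]] [gh [gi _]].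
have [mfr mfi] := holomorphic_measurable fh.
have [mgr mgi] := holomorphic_measurable gh.
set fr := fun p => complex.Re (integrand f p) in mfr.
set fm := fun p => complex.Im (integrand f p) in mfi.
set gr := fun p => complex.Re (integrand g p) in mgr.
set gm := fun p => complex.Im (integrand g p) in mgi.
have mD := @measurable_ball_coords R n.
pose Nf p := complex.Re (integrand (herm_density f f) p).
pose Ng p := complex.Re (integrand (herm_density g g) p).
have hE p : ball p -> exists2 r : R, 0 < r &
    [/\ Nf p = (fr p ^+ 2 + fm p ^+ 2) * r,
        Ng p = (gr p ^+ 2 + gm p ^+ 2) * r,
        complex.Re (integrand (herm_density f g) p) =
          (fr p * gr p + fm p * gm p) * r &
        complex.Im (integrand (herm_density f g) p) =
          (fr p * gm p - fm p * gr p) * r].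
  move=> pD; have [r r0 rE] := rho1_gt0 k (zof p) pD; exists r => //.
  rewrite /Nf /Ng /fr /fm /gr /gm /integrand /herm_density rE !Re_scale Im_scale.
  case: (f _ _) => a b; case: (g _ _) => c d /=.
  by split; congr (_ * _); ring.
(* ln 0 = 0, so that expR (- ln s) inverts s > 0, while the density vanishes
   where s = 0 *)
pose invs p := expR (- ln (fr p ^+ 2 + fm p ^+ 2)).
have minvs : measurable_fun ball invs.
  apply: measurableT_comp => //; apply: measurableT_comp => //.
  apply: measurableT_comp => //.
  by apply: measurable_funD; exact: measurable_funX.
have mNf : measurable_fun ball Nf.
  by move: fi => /integrableP[/measurable_EFinP].
(* Here w is a component of conj(f) g and u its product with the density. The bound w^2 <= |f|^2
   |g|^2 serves twice: for domination, and to make w vanish where f does. *)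
have int_le (u w : coords -> R) : measurable_fun ball w ->
    (forall p, ball p -> exists2 r : R, 0 < r & [/\ u p = w p * r,
       Nf p = (fr p ^+ 2 + fm p ^+ 2) * r, Ng p = (gr p ^+ 2 + gm p ^+ 2) * r
     & w p ^+ 2 <= (fr p ^+ 2 + fm p ^+ 2) * (gr p ^+ 2 + gm p ^+ 2)]) ->
  mu.-integrable ball (EFin \o u).
  move=> mw uw; apply: (@le_integrable _ _ _ mu ball mD _
    (fun p => (Nf p)%:E + (Ng p)%:E)%E).
  - apply/measurable_EFinP.
    apply: (@eq_measurable_fun _ _ _ _ ball (fun p => Nf p * invs p * w p)).
      move=> p /set_mem pD; have [r r0 [-> -> _ wle]] := uw p pD.
      have := sqr_ge0 (fr p); have := sqr_ge0 (fm p); rewrite /invs.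
      move: wle; set s := _ + _ => wle fm0 fr0.
      have : 0 <= s by rewrite addr_ge0.
      rewrite le_eqVlt => /predU1P[s0|s0].
        move: wle; rewrite -s0 mul0r => wle.
        have /eqP := le_anti (introT andP (conj wle (sqr_ge0 (w p)))).
        by rewrite sqrf_eq0 => /eqP ->; rewrite !mul0r.
      by rewrite expRN lnK ?posrE// (mulrAC s) mulfV ?gt_eqF// mul1r mulrC.
    by apply: measurable_funM => //; exact: measurable_funM.
  - move=> p pD; have [r r0 [uE NfE NgE wle]] := uw p pD.
    rewrite -EFinD /= lee_fin uE NfE NgE -mulrDl !normrM (gtr0_norm r0).
    rewrite ler_pM2r//.
    have F0 : 0 <= fr p ^+ 2 + fm p ^+ 2 by rewrite addr_ge0 ?sqr_ge0.
    have G0 : 0 <= gr p ^+ 2 + gm p ^+ 2 by rewrite addr_ge0 ?sqr_ge0.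
    rewrite (ger0_norm (addr_ge0 F0 G0)) -ler_sqr ?nnegrE ?addr_ge0 ?sqr_ge0//.
    rewrite real_normK ?num_real//; nra.
  - exact: (integrableD mD fi gi).
split.
- apply: (int_le _ (fun p => fr p * gr p + fm p * gm p)).
    by apply: measurable_funD; exact: measurable_funM.
  move=> p /hE[r r0 [? ? ? _]]; exists r => //; split => //.
  (* Lagrange's identity: |f|^2 |g|^2 is the sum of the squares of the real and imaginary parts of
     conj(f) g. *)
  rewrite -subr_ge0 (_ : _ - _ = (fr p * gm p - fm p * gr p) ^+ 2) ?sqr_ge0//.
  by ring.
- apply: (int_le _ (fun p => fr p * gm p - fm p * gr p)).
    by apply: measurable_funB; exact: measurable_funM.
  move=> p /hE[r r0 [? ? _ ?]]; exists r => //; split => //.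
  rewrite -subr_ge0 (_ : _ - _ = (fr p * gr p + fm p * gm p) ^+ 2) ?sqr_ge0//.
  by ring.
Qed.

Lemma SJ_integral_FC f g : in_hilbert k f -> in_hilbert k g ->
  SJ_integrable (fun eta W =>
    (f (FC eta W) W)^* * g (FC eta W) W * rho2 k eta W) /\
  SJ_integral (herm_density f g) = SJ_integral (fun eta W =>
    (f (FC eta W) W)^* * g (FC eta W) W * rho2 k eta W).
Proof.
move=> fH gH; have [iRe iIm] := integrable_herm_density fH gH.
set h2 := fun eta W => _.
have ReE p : ball p -> complex.Re (integrand h2 p) =
    complex.Re (integrand (herm_density f g) (FCcoords p)) * \det (FCw p.2).
  by move=> pD; rewrite herm_density_FC// Re_scale.
have ImE p : ball p -> complex.Im (integrand h2 p) =
    complex.Im (integrand (herm_density f g) (FCcoords p)) * \det (FCw p.2).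
  by move=> pD; rewrite herm_density_FC// Im_scale.
have mRe : measurable_fun ball
    (fun p => complex.Re (integrand (herm_density f g) p)).
  by move: iRe => /integrableP[/measurable_EFinP].
have mIm : measurable_fun ball
    (fun p => complex.Im (integrand (herm_density f g) p)).
  by move: iIm => /integrableP[/measurable_EFinP].
split.
  by split; [exact: (integrable_FC ReE mRe iRe)|exact: (integrable_FC ImE mIm iIm)].
by congr (_ +i* _); [exact: (Rintegral_FC ReE mRe)|exact: (Rintegral_FC ImE mIm)].
Qed.

End Integrals.

(** * Wirtinger derivatives *)

Section RealDerivative.
Variable R : realType.
Local Notation C := R[i].

(** Caratheodory's form of the derivative, suited to increments that factor exactly: only the limit
    of the cofactor is then required. *)
Lemma derivable_quotient (h g : R -> R) (l : R) :
  (\forall t \near 0, h t - h 0 = t * g t) -> g t @[t --> 0] --> l ->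
  derivable h 0 1 /\ derive1 h 0 = l.
Proof.
move=> hg gl.
have H : (fun t : R => t^-1 *: ((h \o shift 0) (t *: 1) - h 0)) @ 0^' --> l.
  have : g t @[t --> 0^'] --> l by exact: cvg_within_filter.
  apply: cvg_trans; apply: near_eq_cvg.
  have hg' : \forall t \near (0 : R)^', h t - h 0 = t * g t.
    exact: (@cvg_within _ (nbhs (0 : R))) hg.
  apply: filterS2 hg' (@nbhs_dnbhs_neq R 0) => t ht t0.
  by rewrite /= addr0 /GRing.scale /= mulr1 ht mulrA mulVf// mul1r.
split; first exact/cvgP/H.
by rewrite derive1E; exact: cvg_lim H.
Qed.

Lemma rderive_quotient (h g : R -> C) (l : C) :
  (\forall t \near 0, h t - h 0 = t%:C * g t) ->
  (g t : C^o) @[t --> 0] --> (l : C^o) ->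
  rderivable h /\ rderive h = l.
Proof.
move=> hg gl.
have [] := @derivable_quotient (fun t => complex.Re (h t))
   (fun t => complex.Re (g t)) (complex.Re l).
- apply: filterS hg => t ht; rewrite -raddfB ht /=.
  by case: (g t) => a b /=; rewrite mul0r subr0.
- exact: cvg_Re.
move=> dRe eRe.
have [] := @derivable_quotient (fun t => complex.Im (h t))
   (fun t => complex.Im (g t)) (complex.Im l).
- apply: filterS hg => t ht; rewrite -raddfB ht /=.
  by case: (g t) => a b /=; rewrite mul0r addr0.
- exact: cvg_Im.
move=> dIm eIm; split; first by split.
by rewrite /rderive eRe eIm; case: (l).
Qed.

Lemma cvg_real_complex0 : (t%:C : C^o) @[t --> (0 : R)] --> (0 : C^o).
Proof.
apply/cvgrPdist_lt => e e0; have [r r0 ->] := gt0_real e0.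
have : \forall t \near (0 : R), `|t| < r by exact: nbhs0_lt.
apply: filterS => t tr.
by rewrite sub0r normrN normc_def /= expr0n addr0 sqrtr_sqr ltcR.
Qed.

End RealDerivative.

Lemma half_sub_diff (K : numFieldType) (a b c d e : K) :
  a - 2^-1 * b - 2^-1 * c - (a - 2^-1 * d - 2^-1 * e) =
  - ((b - d + (c - e)) / 2).
Proof. by field. Qed.

Section Wirtinger.
Variables (R : realType) (n : nat).
Local Notation C := R[i].
Implicit Types (W E : 'M[C]_n) (z eta : 'cV[C]_n).

Lemma mxcvg_tr (K : numFieldType) S (F : set_system S) p q
    (A : S -> 'M[K]_(p, q)) A0 :
  mxcvg F A A0 -> mxcvg F (fun x => (A x)^T) A0^T.
Proof. by move=> cA i j; rewrite mxE; under eq_fun do rewrite mxE; exact: cA. Qed.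

Lemma FCinv_FC eta W : 1%:M - W *m cbar W \in unitmx ->
  FCinv (FC eta W) W = eta.
Proof.
move=> uA; rewrite /FCinv /FC cbarB cbarM cbarK mulmxBr.
rewrite addrA subrK mulmxA.
have -> : eta - W *m cbar W *m eta = (1%:M - W *m cbar W) *m eta.
  by rewrite mulmxBl mul1mx.
by rewrite mulKmx.
Qed.

Definition bilin E (a b : 'cV[C]_n) : C := (a^T *m E *m b) 0 0.

Lemma Fdiag_pairing z W : W^T = W -> 1%:M - W *m cbar W \in unitmx ->
  let eta := FCinv z W in
  Fdiag z W = (((cbar z)^T *m eta + z^T *m cbar eta) 0 0) / 2.
Proof.
move=> WT uA eta; have zE : FC eta W = z by exact: FC_FCinv.
have VT : (cbar W)^T = cbar W by rewrite -cbarT WT.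
rewrite -{1}zE Fdiag_FC// -calF_diag /calF DeltaF_diag addr0 /calF0.
have := FC_diag_identity eta (cbar eta) VT WT; rewrite /= => <-.
by rewrite -zE /FC cbarB cbarM cbarK.
Qed.

Lemma Fdiag_diff z W W1 : W^T = W -> W1^T = W1 ->
  1%:M - W *m cbar W \in unitmx -> 1%:M - W1 *m cbar W1 \in unitmx ->
  let eta := FCinv z W in let eta1 := FCinv z W1 in
  Fdiag z W1 - Fdiag z W =
  (bilin (cbar (W1 - W)) eta1 eta + bilin (W1 - W) (cbar eta1) (cbar eta)) / 2.
Proof.
move=> WT W1T uA uA1 eta eta1.
have VT : (cbar W)^T = cbar W by rewrite -cbarT WT.
have V1T : (cbar W1)^T = cbar W1 by rewrite -cbarT W1T.
rewrite !Fdiag_pairing// -/eta -/eta1 -mulrBl; congr (_ / 2).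
rewrite /bilin -addmxE cbarB.
have zE : FC eta W = z by exact: FC_FCinv.
have zE1 : FC eta1 W1 = z by exact: FC_FCinv.
have bz A e : FC e A = z -> cbar e - cbar A *m e = cbar z.
  by move=> <-; rewrite /FC cbarB cbarM cbarK.
have := FC_resolvent_identity (b' := cbar eta1) (a' := cbar eta) VT WT V1T W1T
  (etrans (bz _ _ zE1) (esym (bz _ _ zE))) (etrans zE1 (esym zE)).
rewrite /= (bz _ _ zE) -[eta - _]/(FC eta W) zE => <-.
by rewrite -oppmxE -addmxE.
Qed.

Lemma bilin_scale (s : C) E a b : bilin (s *: E) a b = s * bilin E a b.
Proof. by rewrite /bilin -scalemxAr -scalemxAl mxE. Qed.

Lemma bilinB E E1 a b : bilin (E - E1) a b = bilin E a b - bilin E1 a b.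
Proof. by rewrite /bilin mulmxBr mulmxBl addmxE oppmxE. Qed.

Lemma calFdiagE eta W : calFdiag eta W =
  dotp eta eta - 2^-1 * bilin (cbar W) eta eta
    - 2^-1 * bilin W (cbar eta) (cbar eta).
Proof. by rewrite /calFdiag addmxE oppmxE scalemxE addmxE oppmxE scalemxE. Qed.

(** At fixed eta the exponent is affine in W and conj(W). Its increment is that of [Fdiag_diff] with
    both preimages equal to eta and the sign reversed, which is the source of the opposite
    gradients. *)
Lemma calFdiag_diff eta W W1 :
  calFdiag eta W1 - calFdiag eta W =
  - ((bilin (cbar (W1 - W)) eta eta + bilin (W1 - W) (cbar eta) (cbar eta)) / 2).
Proof.
by rewrite !calFdiagE cbarB !bilinB half_sub_diff.
Qed.

Lemma conjc_scale (t : R) (c : C) : (t%:C * c)^*%C = t%:C * c^*%C.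
Proof. by case: c => a b; simpc. Qed.

Lemma half_scale (K : numFieldType) (t a b u v : K) :
  (t * a * u + t * b * v) / 2 = t * ((a * u + b * v) / 2).
Proof. by rewrite mulrA mulrDr !mulrA. Qed.

Section Direction.
Variables (E : 'M[C]_n) (c : C).
Hypotheses (ET : E^T = E) (Er : cbar E = E).

(** The scalar [c] will be 1 and i, so one computation serves both real directions of a Wirtinger
    derivative; conj(c) marks the antiholomorphic part. *)
Lemma rderive_calFdiag eta W :
  let h (t : R) := calFdiag eta (W + (t%:C * c) *: E) in
  let l := - ((c^*%C * bilin E eta eta + c * bilin E (cbar eta) (cbar eta)) / 2) in
  rderivable h /\ rderive h = l.
Proof.
move=> h l; apply: (@rderive_quotient _ h (fun=> l)); last exact: cvg_cst.
have hl t : h t - h 0 = t%:C * l.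
  rewrite /h calFdiag_diff !mul0r scale0r addr0 [W + _]addrC addrK.
  rewrite cbarZ Er !bilin_scale.
  rewrite conjc_scale.
  by rewrite half_scale /l mulrN.
exact: (@filterE _ (nbhs (0 : R)) _ _ hl).
Qed.

Lemma rderive_Fdiag z W : W^T = W -> 1%:M - W *m cbar W \in unitmx ->
  let h (t : R) := Fdiag z (W + (t%:C * c) *: E) in
  let eta := FCinv z W in
  let l := (c^*%C * bilin E eta eta + c * bilin E (cbar eta) (cbar eta)) / 2 in
  rderivable h /\ rderive h = l.
Proof.
move=> WT uA h eta l.
have F0 : Filter (nbhs (0 : R)) by exact: nbhs_filter.
pose Wt (t : R) : 'M[C]_n := W + (t%:C * c) *: E.
pose et (t : R) := FCinv z (Wt t).
have WtT t : (Wt t)^T = Wt t by rewrite /Wt linearD linearZ /= ET WT.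
have cWt : mxcvg (nbhs (0 : R)) Wt W.
  move=> i j; rewrite -[W i j]addr0 -[X in _ + X](mul0r (c * E i j)).
  under eq_fun do rewrite /Wt addmxE scalemxE -mulrA.
  apply: cvgD; first exact: cvg_cst.
  by apply: cvgM; [exact: cvg_real_complex0|exact: cvg_cst].
have cAt : mxcvg (nbhs (0 : R)) (fun t => 1%:M - Wt t *m cbar (Wt t))
    (1%:M - W *m cbar W).
  have c1 := mxcvgM F0 cWt (mxcvg_cbar F0 cWt).
  have c2 := mxcvgN F0 c1.
  by apply: mxcvgD c2; exact: mxcvg_cst.
have cet : mxcvg (nbhs (0 : R)) et eta.
  apply: (mxcvgM F0 (mxcvgV F0 cAt uA)); apply: mxcvgD.
    exact: mxcvg_cst.
  by apply: (mxcvgM F0 cWt); exact: mxcvg_cst.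
(* The cofactor pairs the moving preimage [et t] with the fixed [eta]. The factorisation holds for
   small t, where 1 - W_t conj(W_t) is still invertible. *)
apply: (@rderive_quotient _ h (fun t =>
  (c^*%C * bilin E (et t) eta + c * bilin E (cbar (et t)) (cbar eta)) / 2)).
- apply: filterS (near_unitmx F0 cAt uA) => t ut.
  have h0 : h 0 = Fdiag z W by rewrite /h mul0r scale0r addr0.
  rewrite h0 -[h t]/(Fdiag z (Wt t)) Fdiag_diff// -/eta -/(et t).
  have -> : Wt t - W = (t%:C * c) *: E by rewrite /Wt [W + _]addrC addrK.
  rewrite cbarZ Er !bilin_scale.
  rewrite conjc_scale.
  exact: half_scale.
- have cf (a b : R -> 'cV[C]_n) a0 b0 : mxcvg (nbhs (0 : R)) a a0 ->
      mxcvg (nbhs (0 : R)) b b0 ->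
      (bilin E (a t) (b t) : C^o) @[t --> (0 : R)] --> (bilin E a0 b0 : C^o).
    move=> ca cb; rewrite /bilin.
    have c1 : mxcvg (nbhs (0 : R)) (fun t => (a t)^T *m E) (a0^T *m E).
      by apply: (mxcvgM F0 (mxcvg_tr ca)); exact: mxcvg_cst.
    exact: (mxcvgM F0 c1 cb).
  apply: cvgM; last exact: cvg_cst.
  apply: cvgD; (apply: cvgM; first exact: cvg_cst).
    by apply: (cf _ _ _ _ cet); exact: mxcvg_cst.
  by apply: (cf _ _ _ _ (mxcvg_cbar F0 cet)); exact: mxcvg_cst.
Qed.

End Direction.

End Wirtinger.

(** With e = i and e' = -i, subtracting i times the imaginary direction cancels the antiholomorphic
    coefficient a' and doubles a. *)
Lemma wirtinger_combination (K : numFieldType) (e e' k a a' : K) :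
  e * e = -1 -> e * e' = 1 ->
  (k * ((1 * a' + 1 * a) / 2) - e * (k * ((e' * a' + e * a) / 2))) / 2 =
  k * (a / 2).
Proof.
move=> ee ee'.
have -> : e * (k * ((e' * a' + e * a) / 2)) = k * ((a' - a) / 2).
  rewrite mulrCA; congr (_ * _).
  by rewrite mulrA mulrDr !(mulrA e) ee ee' mul1r mulN1r.
by field.
Qed.

(** * Wirtinger derivatives along the symmetric coordinate directions *)

Section WirtingerDsym.
Variables (R : realType) (n : nat).
Local Notation C := R[i].
Implicit Types (W : 'M[C]_n) (eta b : 'cV[C]_n) (p q : 'I_n).

Lemma cbar_dsym p q : cbar (dsym R p q) = dsym R p q.
Proof.
by apply/matrixP => i j; rewrite !mxE rmorphB rmorphD !rmorphM /= !rmorph_nat.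
Qed.

(** With E_pq the matrix units, the direction is E_pq + E_qp - delta_pq E_pp; the correction keeps a
    diagonal variable from being counted twice. *)
Lemma bilin_dsym p q b :
  bilin (dsym R p q) b b = 2 * (b p 0 * b q 0) - (p == q)%:R * (b p 0 * b q 0).
Proof.
have bilin_delta i j : bilin (delta_mx i j) b b = b i 0 * b j 0.
  rewrite /bilin mxE (bigD1 j)//= big1 => [|l lj]; last first.
    by rewrite mxE big1 ?mul0r// => k _; rewrite !mxE (negPf lj) andbF mulr0.
  rewrite addr0 mxE (bigD1 i)//= big1 => [|k ki]; last first.
    by rewrite !mxE (negPf ki) mulr0.
  by rewrite !mxE !eqxx mulr1 addr0.
have -> : dsym R p q = delta_mx p q - ((p == q)%:R *: delta_mx p p - delta_mx q p).
  apply/matrixP => i j; rewrite !mxE -!mulnb !natrM opprB addrA.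
  congr (_ - _); rewrite [_ * (p == q)%:R]mulrC -mulrA; congr (_ * _).
  by have [->|_] := eqVneq i p; rewrite ?mulr0 ?mul0r// mulr1 mul1r eq_sym.
rewrite !bilinB bilin_scale !bilin_delta; have [->|_] := eqVneq p q.
  by rewrite !mul1r; ring.
by rewrite !mul0r; ring.
Qed.

(** The factor [k] is the sign separating the two exponents: 1 for F at fixed z, -1 for the
    transformed one at fixed eta. *)
Lemma wirtinger_bilin G W p q (k a a' : C) :
  (forall c : C,
     rderivable (fun t : R => G (W + (t%:C * c) *: dsym R p q)) /\
     rderive (fun t : R => G (W + (t%:C * c) *: dsym R p q)) =
       k * ((c^*%C * a' + c * a) / 2)) ->
  wirtinger_derivable G W p q /\ wirtinger G W p q = k * (a / 2).
Proof.
move=> dG; have [d1 e1] := dG 1; have [di ei] := dG (0 +i* 1).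
have reE : along_re G W p q = fun t : R => G (W + (t%:C * 1) *: dsym R p q).
  by apply/funext => t; rewrite mulr1.
have imE : along_im G W p q = fun t : R => G (W + (t%:C * (0 +i* 1)) *: dsym R p q).
  by apply/funext => t; rewrite /along_im; congr (G (W + _ *: _)); simpc.
rewrite /wirtinger_derivable /wirtinger reE imE e1 ei; split; first by [].
rewrite conjc1; apply: wirtinger_combination; first by rewrite -expr2 sqr_i.
by simpc.
Qed.

Lemma wirtinger_Fdiag z W p q : W^T = W -> 1%:M - W *m cbar W \in unitmx ->
  let b := cbar (FCinv z W) in
  wirtinger_derivable (fun W' => Fdiag z W') W p q /\
  wirtinger (fun W' => Fdiag z W') W p q = bilin (dsym R p q) b b / 2.
Proof.
move=> WT uA b; rewrite -[X in _ = X]mul1r.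
apply: (@wirtinger_bilin _ _ _ _ 1 _ (bilin (dsym R p q) (FCinv z W) (FCinv z W))).
move=> c; rewrite mul1r.
exact: (rderive_Fdiag c (dsym_tr R p q) (cbar_dsym p q) z WT uA).
Qed.

Lemma wirtinger_calFdiag eta W p q :
  let b := cbar eta in
  wirtinger_derivable (fun W' => calFdiag eta W') W p q /\
  wirtinger (fun W' => calFdiag eta W') W p q = - (bilin (dsym R p q) b b / 2).
Proof.
move=> b; rewrite -mulN1r.
apply: (@wirtinger_bilin _ _ _ _ (-1) _ (bilin (dsym R p q) eta eta)).
move=> c; rewrite mulN1r.
exact: (rderive_calFdiag c (cbar_dsym p q) eta W).
Qed.

End WirtingerDsym.

Lemma half_twice_sub (K : numFieldType) (x d : K) :
  - ((2 * x - d * x) / 2) = - x + 2^-1 * x * d.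
Proof. by field. Qed.

(** The weight of nabla undoes the symmetric counting: (1 + d)(2 - d) = 2 for d equal to 0 or 1,
    hence the boolean. *)
Lemma nabla_weight (K : numFieldType) (b : bool) (x : K) :
  (1 + b%:R) / 2 * ((2 * x - b%:R * x) / 2) = 2^-1 * x.
Proof. by case: b => /=; field. Qed.

Theorem corollary1 (R : realType) (n : nat) (k Lambda : R) (n_gt0 : (0 < n)%N) :
  [/\ (forall (eta xi : 'cV[R[i]]_n) (V W : 'M[R[i]]_n),
          siegel_ball V -> siegel_ball W ->
          kernel k (FC eta V) V (FC xi W) W =
          det_pow (Umx V W) (k / 2) * cexp (calF eta V xi W)),
      (forall (eta : 'cV[R[i]]_n) (W : 'M[R[i]]_n), siegel_ball W ->
          DeltaF eta W eta W = 0 /\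
          kernel k (FC eta W) W (FC eta W) W =
          cpow (\det (Mmx W)) (k / 2) * cexp (calFdiag eta W)),
      (forall f g : 'cV[R[i]]_n -> 'M[R[i]]_n -> R[i],
          in_hilbert k f -> in_hilbert k g ->
          SJ_integrable (fun eta W =>
            (f (FC eta W) W)^* * g (FC eta W) W * rho2 k eta W) /\
          Lambda%:C * SJ_integral (fun z W => (f z W)^* * g z W * rho1 k z W) =
          Lambda%:C * SJ_integral (fun eta W =>
            (f (FC eta W) W)^* * g (FC eta W) W * rho2 k eta W))
    & (forall (z eta : 'cV[R[i]]_n) (W : 'M[R[i]]_n),
          siegel_ball W -> z = FC eta W ->
          (forall i j : 'I_n,
             [/\ wirtinger_derivable (fun W' => Fdiag z W') W i j,
                 wirtinger_derivable (fun W' => calFdiag eta W') W i j,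
                 - wirtinger (fun W' => Fdiag z W') W i j =
                 wirtinger (fun W' => calFdiag eta W') W i j
               & wirtinger (fun W' => calFdiag eta W') W i j =
                 - (cbar eta i 0 * cbar eta j 0)
                 + 2^-1 * (cbar eta i 0 * cbar eta j 0) * (i == j)%:R]) /\
          nabla (fun W' => Fdiag z W') W = - nabla (fun W' => calFdiag eta W') W /\
          nabla (fun W' => Fdiag z W') W = 2^-1 *: outer (cbar eta) (cbar eta))].
Proof.
split.
- move=> eta xi V W VD WD.
  by rewrite /kernel Fexp_FC ?siegel_unit// siegel_sym.
- move=> eta W WD; split; first exact: DeltaF_diag.
  rewrite /kernel Fexp_FC ?siegel_unit ?siegel_sym// calF_diag.
  by rewrite -[Umx W W]/(Mmx W) det_pow_Mmx.
- by move=> f g fH gH; have [? <-] := SJ_integral_FC fH gH.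
move=> z eta W WD zE; have WT := siegel_sym WD; have uA := siegel_unit1 WD.
have dF i j := wirtinger_Fdiag z i j WT uA.
have dc i j := wirtinger_calFdiag eta W i j.
have etaE : FCinv z W = eta by rewrite zE FCinv_FC.
rewrite /= etaE in dF.
have dFE i j : wirtinger (fun W' => Fdiag z W') W i j =
    - wirtinger (fun W' => calFdiag eta W') W i j.
  by rewrite (dF i j).2 (dc i j).2 opprK.
split; last split.
- move=> i j; split.
  + exact: (dF i j).1.
  + exact: (dc i j).1.
  + by rewrite dFE opprK.
  + by rewrite (dc i j).2 bilin_dsym half_twice_sub.
- by apply/matrixP => i j; rewrite !mxE dFE mulrN.
- by apply/matrixP => i j; rewrite !mxE (dF i j).2 bilin_dsym nabla_weight !mxE.
Qed.
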